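(* There exist a constant $C>0$ and a positive integer $L$ such that for all bounded continuous functions $f$ on $[0,\infty)$ and all $\ell,n\in\mathbb{N}$ with $\ell\ge Ln$, $$K\Big(f,\frac{1}{n^2}\Big)\le C\,\frac{\ell^2}{n^2}\Big(\big\|\widetilde{V}_nf-f\big\|+\big\|\widetilde{V}_\ell f-f\big\|\Big).$$ In particular, there is a constant $C'>0$ such that for all such $f$ and all $n\in\mathbb{N}$, $$K\Big(f,\frac{1}{n^2}\Big)\le C'\Big(\big\|\widetilde{V}_nf-f\big\|+\big\|\widetilde{V}_{Ln} f-f\big\|\Big).$$ The constants $C$, $C'$ are independent of $f$, $\ell$ and $n$.
   Context: For $n\in\mathbb{N}=\{1,2,\ldots\}$, $k=0,1,2,\ldots$ and $x\in[0,\infty)$ let $P_{n,k}(x)=\binom{n+k-1}{k}x^k(1+x)^{-n-k}$. Let $\psi(x)=x(1+x)$ and define the differential operator $\widetilde{D}f(x)=\psi(x)f''(x)$, with $\widetilde{D}^2f=\widetilde{D}\widetilde{D}f$. For Lebesgue measurable $f$ on $(0,\infty)$ with a finite limit $f(0)=\lim_{x\to0^+}f(x)$ put $v_{n,0}(f)=f(0)$ and $v_{n,k}(f)=(n+1)\int_0^\infty P_{n+2,k-1}(t)f(t)\,dt$ for $k\ge1$. Set $\widetilde{P}_{n,k}(x)=P_{n,k}(x)-\frac1n\widetilde{D}P_{n,k}(x)$ and $$\widetilde{V}_n(f,x)=\sum_{k=0}^\infty v_{n,k}(f)\widetilde{P}_{n,k}(x),\qquad x\in[0,\infty).$$ $\|\cdot\|$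 is the uniform (essential supremum) norm on $[0,\infty)$. $AC_{loc}(0,\infty)$ is the set of functions absolutely continuous on every $[a,b]\subset(0,\infty)$. $W^2(\psi)=\{g: g,g'\in AC_{loc}(0,\infty),\ \widetilde{D}g\in L_\infty[0,\infty)\}$, and $W_0^2(\psi)$ is the subspace of those $g\in W^2(\psi)$ with $\lim_{x\to0^+}\widetilde{D}g(x)=0$. For $t>0$ the K-functional is $$K(f,t)=\inf\{\|f-g\|+t\|\widetilde{D}^2g\| : g\in W_0^2(\psi),\ \widetilde{D}g\in W^2(\psi)\}.$$ *)

(* Defs.v *)
From HB Require Import structures.
From mathcomp Require Export all_boot all_order all_algebra.
From mathcomp Require Export all_classical all_reals all_analysis.

Set Implicit Arguments.
Unset Strict Implicit.
Unset Printing Implicit Defensive.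
Export Order.TTheory GRing.Theory Num.Theory.
Export numFieldNormedType.Exports.

Local Open Scope classical_set_scope.
Local Open Scope ring_scope.

(* Functions on [0, oo) or (0, oo) are represented by total functions R -> R;
   every notion below depends only on the values on the relevant half-line. *)

Section Definitions.
Context {R : realType}.
Implicit Types (f g h : R -> R) (n k : nat) (x t a b : R).

Local Notation mu := (@lebesgue_measure R).

Definition psi x : R := x * (1 + x).

(* [derive1] is 0 at points of non-differentiability. When [Dt g] is locally
   absolutely continuous on (0, oo), as in the K-functional, g' and g'' exist
   everywhere there and this default value is never used. *)
Definition Dt f : R -> R := fun x => psi x * (f^`()^`())%classic x.

Definition P n k : R -> R :=
  fun x => 'C((n + k).-1, k)%:R * x ^+ k * (1 + x) ^- (n + k).

Definition Pt n k : R -> R := fun x => P n k x - n%:R^-1 * Dt (P n k) x.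

Definition v n k f : R :=
  if k is k'.+1 then
    n.+1%:R * \int[mu]_(t in `]0, +oo[) (P n.+2 k' t * f t)
  else lim (f t @[t --> 0^'+]).

Definition Vt n f : R -> R := fun x => limn (series (fun k => v n k f * Pt n k x)).

Definition unorm h : \bar R :=
  ('N[mu]_+oo[EFin \o (h \_ `[0, +oo[)%R])%E.

Definition Linfty h : Prop := h \_ `[0, +oo[ \in Lfun mu +oo%E.

Definition abs_cont_on a b f : Prop :=
  forall e : R, 0 < e -> exists2 d : R, 0 < d &
    forall (m : nat) (I : 'I_m -> R * R),
      (forall i, a <= (I i).1 /\ (I i).1 <= (I i).2 /\ (I i).2 <= b) ->
      trivIset setT (fun i => `](I i).1, (I i).2[%classic) ->
      \sum_(i < m) ((I i).2 - (I i).1) < d ->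
      \sum_(i < m) `|f (I i).2 - f (I i).1| < e.

Definition ACloc f : Prop :=
  forall a b, 0 < a -> a <= b -> abs_cont_on a b f.

(* A function having a (locally absolutely) continuous derivative is
   differentiable everywhere, hence the first clause. *)
Definition W2 g : Prop :=
  [/\ forall x, 0 < x -> derivable g x 1,
      ACloc g, ACloc (g^`())%classic & Linfty (Dt g)].

Definition W20 g : Prop := W2 g /\ Dt g x @[x --> 0^'+] --> (0 : R).

Definition Kfun f t : \bar R :=
  ereal_inf [set (unorm (f \- g)%R + t%:E * unorm (Dt (Dt g)))%E
            | g in [set g | W20 g /\ W2 (Dt g)]].

Definition bounded_continuous f : Prop :=
  {within `[0, +oo[, continuous f} /\
  exists M : R, forall x, 0 <= x -> `|f x| <= M.

End Definitions.

(* Main.v *)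
Require Import Defs.
From mathcomp Require Import ring lra measurable_realfun ess_sup_inf.

(** The unmodified operators Vop n f = sum_k v n k f * P n k satisfy
      Vop (n + 1) = (1 - Dt / (n (n + 1))) Vop n,
    so that Vop n is formally the product over j >= n of the resolvents
    (1 - Dt / (j (j + 1)))^-1, and Vt n = (1 - Dt / n) Vop n. Everything
    commutes with Dt, and since Vop n g tends to g pointwise,
      Vt n g - g = - sum_(j >= n) Vop j (Dt^2 g) / (j (j + 1)^2).
    With Vop j u = u + O(|Dt u| / j) this is a Voronovskaya estimate
    (voronovskaya)
      Vt n g - g = - Dt^2 g / (2 n^2) + O((|Dt^3 g| + |Dt^2 g|) / n^3).

    The other ingredient is a Bernstein inequality. In the basis P n, the
    operator Dt acts on coefficients as the weighted second difference
    (lap n a) k = k (n + k) (a (k+1) - 2 a k + a (k-1)). This operation costs a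
    factor O(n) on both sides of Vop n: on the functions P n k summed against
    bounded coefficients (bernstein_sum) and on the functionals v n k
    (bernstein_int). Using the second one, Vt n f has bounded coefficients;
    using then the first one, |Dt (Vt n f)| <= 272 n |f|.

    For the converse inequality take g = Vt n (Vt n (Vt n f)). Boundedness of
    Vt n gives |f - g| = O(|Vt n f - f|), and therefore |Vt l g - g| is at
    most a constant times |Vt n f - f| + |Vt l f - f|. The Bernstein
    inequality gives
      |Dt^3 g| = O(n) (|Dt^2 g| + n^2 O(|Vt n f - f|)).
    Inserting this in the Voronovskaya estimate at level l, the contribution
    of |Dt^2 g| to the remainder is O(n / l) |Dt^2 g| / l^2. For l >= L n with L
    large it is absorbed by the left-hand side, whence
    |Dt^2 g| <= C l^2 (|Vt n f - f| + |Vt l f - f|), and g is the required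
    competitor in the K-functional (converse_bound, Kfun_le_defect). *)

Set Implicit Arguments.
Unset Strict Implicit.
Unset Printing Implicit Defensive.

Local Open Scope classical_set_scope.
Local Open Scope ring_scope.

(** * Sums of series *)

Section Series.
Context {R : realType}.
Implicit Types (u v a : nat -> R) (l m c M : R).

(** Convergence and value are stated together because [limn] returns a
    meaningless default on a divergent series. *)
Definition sums_to u l : Prop := cvgn (series u) /\ limn (series u) = l.

Lemma sums_toP u l : sums_to u l <-> series u @ \oo --> l.
Proof.
by split=> [[c <-]//|h]; split; [apply/cvg_ex; exists l | exact: cvg_lim].
Qed.

Lemma sums_to_cvg u : cvgn (series u) -> sums_to u (limn (series u)).
Proof. by []. Qed.

Lemma sums_to_uniq u l m : sums_to u l -> sums_to u m -> l = m.
Proof. by move=> [_ <-] [_ <-]. Qed.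

Lemma sums_to_eq u v l : sums_to u l -> u =1 v -> sums_to v l.
Proof. by move=> h /funext <-. Qed.

Lemma sums_toD u v l m : sums_to u l -> sums_to v m -> sums_to (fun k => u k + v k) (l + m).
Proof. by move=> /sums_toP hu /sums_toP hv; apply/sums_toP; rewrite (seriesD u v); exact: cvgD. Qed.

Lemma sums_toZ c u l : sums_to u l -> sums_to (fun k => c * u k) (c * l).
Proof. by move=> /sums_toP hu; apply/sums_toP; rewrite (seriesZ u c); exact: cvgZl_tmp. Qed.

Lemma sums_toB u v l m : sums_to u l -> sums_to v m -> sums_to (fun k => u k - v k) (l - m).
Proof.
move=> hu hv; have := sums_toD hu (sums_toZ (-1) hv); rewrite mulN1r => h.
by apply: (sums_to_eq h) => k; rewrite mulN1r.
Qed.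

Lemma sums_to_shift u l : sums_to (fun k => u k.+1) l <-> sums_to u (u 0%N + l).
Proof.
have e : (fun N => series u N.+1) = fun N => u 0%N + series (fun k => u k.+1) N.
  by apply/funext => N; rewrite /series/= big_nat_recl.
split=> /sums_toP h; apply/sums_toP.
  rewrite -cvg_shiftS /= e.
  by apply: cvgD h; exact: cvg_cst.
rewrite -cvg_shiftS /= e in h.
have -> : series (fun k => u k.+1) = fun N => u 0%N + series (fun k => u k.+1) N - u 0%N.
  by apply/funext => N; rewrite addrC addKr.
rewrite -[l](addrK (u 0%N)) [l + _]addrC; apply: cvgB h _; exact: cvg_cst.
Qed.

Lemma sums_to_le u v l m : sums_to u l -> sums_to v m -> (forall k, u k <= v k) -> l <= m.
Proof.
by move=> [hu <-] [hv <-] uv; exact: lim_series_le. Qed.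

Lemma sums_to_dom u v m : (forall k, `|u k| <= v k) -> sums_to v m ->
  exists2 s, sums_to u s & `|s| <= m.
Proof.
move=> uv hv.
have c : cvgn [normed series u].
  apply: (@series_le_cvg _ _ v) => [k|k|//|].
  - exact: normr_ge0.
  - by apply: le_trans (uv k); exact: normr_ge0.
  - by case: hv.
have c' := normed_cvg c; exists (limn (series u)) => //.
by rewrite (le_trans (lim_series_norm c))//; exact: sums_to_le (sums_to_cvg c) hv uv.
Qed.

Lemma sums_to_bounded a u l M : (forall k, `|a k| <= M) -> (forall k, 0 <= u k) ->
  sums_to u l -> exists2 s, sums_to (fun k => a k * u k) s & `|s| <= M * l.
Proof.
move=> aM u0 hu; apply: sums_to_dom (sums_toZ M hu) => k.
by rewrite normrM (ger0_norm (u0 k)) ler_wpM2r.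
Qed.

Lemma sums_to_delta u j : sums_to (fun k => (k == j)%:R * u k) (u j).
Proof.
apply/sums_toP; apply: cvg_near_cst; near=> N.
have jN : (j < N)%N by near: N; exact: nbhs_infty_gt.
rewrite /series/= big_mkord (bigD1 (Ordinal jN))//= eqxx mul1r big1 ?addr0//.
by move=> i /eqP ij; rewrite (_ : _ == j = false) ?mul0r//; apply/eqP => h; apply: ij; exact: val_inj.
Unshelve. all: by end_near. Qed.

End Series.
Arguments sums_toZ {R} c {u l} _.

(** * Baskakov series with bounded coefficients *)

Section Basis.
Context {R : realType}.
Implicit Types (x y t M : R) (n k : nat) (a b : nat -> R).

Lemma P_ge0 n k x : 0 <= x -> 0 <= P n k x.
Proof.
move=> x0; rewrite /P !mulr_ge0 ?exprn_ge0 ?invr_ge0 ?exprn_ge0//.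
by rewrite addr_ge0.
Qed.

Lemma P_recl n k x : k.+1%:R * P n k.+1 x = n%:R * x * P n.+1 k x.
Proof.
rewrite /P addnS addSn /= exprS.
have := mul_bin_left (n + k) k; rewrite addnK => /(congr1 (fun m => m%:R : R)).
rewrite !natrM => e.
by rewrite !mulrA e -!mulrA; congr (_ * _); rewrite mulrCA.
Qed.

Lemma P_recr n k x : 1 + x != 0 ->
  (n + k)%:R * P n k x = n%:R * (1 + x) * P n.+1 k x.
Proof.
move=> x1; rewrite /P addSn /=.
have := mul_bin_down (n + k) k; rewrite addnK => /(congr1 (fun m => m%:R : R)).
rewrite !natrM => e.
rewrite !mulrA e -!mulrA; congr (_ * _).
by rewrite exprS; field; rewrite x1 expf_neq0.
Qed.

Lemma P_succ n k x : 1 + x != 0 ->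
  n%:R * P n.+1 k x = (n + k)%:R * P n k x - k.+1%:R * P n k.+1 x.
Proof. by move=> x1; rewrite P_recl P_recr//; ring. Qed.

(** Multiplication by psi raises [n] by two: this is what makes
    psi * (P n k)'' a combination of neighbouring basis functions. *)
Lemma P_psi n k x : 1 + x != 0 ->
  (k.+1 * (n + k.+1))%:R * P n k.+1 x = (n * n.+1)%:R * psi x * P n.+2 k x.
Proof.
move=> x1; have e := P_recr n.+1 k x1.
transitivity ((n + k.+1)%:R * (k.+1%:R * P n k.+1 x)); first by rewrite natrM; ring.
rewrite P_recl addnS -addSn.
transitivity (n%:R * x * ((n.+1 + k)%:R * P n.+1 k x)); first by ring.
by rewrite e natrM /psi; ring.
Qed.

Lemma P1_sums_to x : 0 <= x -> sums_to (fun k => P 1 k x) 1.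
Proof.
move=> x0; have x1 : 0 < 1 + x by lra.
have -> : (fun k => P 1 k x) = geometric (1 + x)^-1 (x / (1 + x)).
  apply/funext => k; rewrite /P add1n /= binn mul1r /geometric/= expr_div_n exprS.
  by rewrite invfM; ring.
have e : (1 + x)^-1 / (1 - x / (1 + x)) = 1.
  by field; rewrite lt0r_neq0 //= addrK oner_neq0.
rewrite -[X in sums_to _ X]e; apply/sums_toP; apply: cvg_geometric_series.
by rewrite ger0_norm ?divr_ge0 ?ltr_pdivrMr//; lra.
Qed.

Lemma sumP_succ n N x : 1 + x != 0 ->
  series (fun k => P n.+1 k x) N.+1 =
  series (fun k => P n.+2 k x) N.+1 + x * P n.+2 N x.
Proof.
move=> x1; elim: N => [|N IH].
  rewrite /series/= !big_nat1.
  have := P_succ n.+1 0 x1; rewrite P_recl addn0 => e.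
  apply: (mulfI (_ : n.+1%:R != 0 :> R)); first by rewrite pnatr_eq0.
  by rewrite mulrDr e; ring.
rewrite seriesSr IH [in RHS]seriesSr -!addrA; congr (_ + _).
apply: (mulfI (_ : n.+1%:R != 0 :> R)); first by rewrite pnatr_eq0.
have := P_succ n.+1 N.+1 x1; rewrite P_recl => e.
have := P_recl n.+1 N x; lra.
Qed.

(** Summing P_succ over k telescopes, and the correction x * P n.+2 N x is a
    term of a convergent series; so the sum does not depend on [n], and for
    n = 1 the series is geometric. *)
Lemma P_sums_to n x : 0 <= x -> sums_to (fun k => P n.+1 k x) 1.
Proof.
move=> x0; have x1 : 1 + x != 0 by rewrite lt0r_neq0//; lra.
elim: n => [|n IH]; first exact: P1_sums_to.
have nd (m : nat) : nondecreasing_seq (series (fun k => P m k x)).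
  by apply: nondecreasing_series => k _ _; exact: P_ge0.
have c2 : cvgn (series (fun k => P n.+2 k x)).
  apply: nondecreasing_is_cvgn; first exact: nd.
  exists 1 => _ [N _ <-].
  apply: (@le_trans _ _ (series (fun k => P n.+1 k x) N.+1)).
    rewrite sumP_succ// (le_trans (nd _ N N.+1 (leqnSn _)))//.
    by rewrite lerDl mulr_ge0// P_ge0.
  by case: IH => c <-; apply: nondecreasing_cvgn_le.
have t0 : x * P n.+2 N x @[N --> \oo] --> x * 0.
  by apply: cvgMl_tmp; exact: (cvg_series_cvg_0 c2).
move/sums_toP: IH; rewrite -cvg_shiftS => IH; apply/sums_toP; rewrite -cvg_shiftS.
have -> : 1 = 1 - x * 0 :> R by rewrite mulr0 subr0.
rewrite [X in X @ _ --> _](_ : _ = fun N => series (fun k => P n.+1 k x) N.+1 - x * P n.+2 N x).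
  exact: (cvgB IH t0).
by apply/funext => N; rewrite sumP_succ// addrK.
Qed.

(** The operator sending the coefficient sequence [a] to the Baskakov series
    with basis functions [P n]. *)
Definition Psum n a x : R := limn (series (fun k => a k * P n k x)).

Definition bseq a M : Prop := forall k, `|a k| <= M.

(** Coefficients of the power series in x / (1 + x) that remains when
    (1 + x)^-(n+1) is factored out of a Baskakov series. *)
Definition hcoef n a k : R := 'C(n + k, k)%:R * a k.

Lemma hcoefE n a k x : a k * P n.+1 k x =
  (1 + x)^-1 ^+ n.+1 * (hcoef n a k * (x / (1 + x)) ^+ k).
Proof. by rewrite /P /hcoef addSn /= exprMn -!exprVn -addSn exprD; ring. Qed.

(** A radius w in [0, 1) is the value of x / (1 + x) at the nonnegative point
    x = w / (1 - w), where the convergence is that of P_sums_to. *)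
Lemma cvg_hcoef n a M z : bseq a M -> `|z| < 1 -> cvgn (pseries (hcoef n a) z).
Proof.
move=> aM z1; pose w : R := (1 + `|z|) / 2; pose x : R := w / (1 - w).
have w0 : 0 <= w by rewrite /w; have := normr_ge0 z; lra.
have w1 : w < 1 by rewrite /w; lra.
have x0 : 0 <= x by rewrite divr_ge0//; lra.
have xE : 1 + x = (1 - w)^-1 by rewrite /x; field; lra.
have wE : x / (1 + x) = w by rewrite xE /x; field; lra.
apply: (@is_cvg_pseries_inside _ _ w); last by rewrite (ger0_norm w0) /w; lra.
have [s hs _] := sums_to_bounded aM (fun k => P_ge0 n.+1 k x0) (P_sums_to n x0).
have := sums_toZ ((1 + x) ^+ n.+1) hs => {}hs.
suff /sums_toP h : sums_to (fun k => hcoef n a k * w ^+ k) ((1 + x) ^+ n.+1 * s).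
  by apply/cvg_ex; exists ((1 + x) ^+ n.+1 * s).
apply: (sums_to_eq hs) => k; rewrite hcoefE wE mulrA -exprMn divff ?expr1n ?mul1r//.
by rewrite xE invr_neq0//; lra.
Qed.

(** The condition - 1/2 < x gives a two-sided neighbourhood of 0 on which the
    power series converges, so that derivatives at 0 need no one-sided limits. *)
Lemma ratio_lt1 x : - 2^-1 < x -> `|x / (1 + x)| < 1.
Proof.
move=> hx; have x1 : 0 < 1 + x by lra.
by rewrite normrM normfV (ger0_norm (ltW x1)) ltr_pdivrMr// mul1r ltr_norml; lra.
Qed.

Lemma Psum_sums_to n a M x : bseq a M -> - 2^-1 < x ->
  sums_to (fun k => a k * P n.+1 k x) (Psum n.+1 a x).
Proof.
move=> aM hx; suff : cvgn (series (fun k => a k * P n.+1 k x)) by [].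
have /sums_to_cvg hl := @cvg_hcoef n a M _ aM (ratio_lt1 hx).
have [c _] := sums_toZ ((1 + x)^-1 ^+ n.+1) hl.
by under eq_fun do rewrite hcoefE.
Qed.

Lemma Psum_pseriesE n a M x : bseq a M -> - 2^-1 < x ->
  Psum n.+1 a x = (1 + x)^-1 ^+ n.+1 * limn (pseries (hcoef n a) (x / (1 + x))).
Proof.
move=> aM hx; apply: sums_to_uniq (Psum_sums_to n aM hx) _.
have /sums_to_cvg hl := @cvg_hcoef n a M _ aM (ratio_lt1 hx).
by apply: (sums_to_eq (sums_toZ ((1 + x)^-1 ^+ n.+1) hl)) => k; rewrite hcoefE.
Qed.

Lemma Psum_bnd n a M x : bseq a M -> 0 <= x -> `|Psum n.+1 a x| <= M.
Proof.
move=> aM x0; have [s hs] := sums_to_bounded aM (fun k => P_ge0 n.+1 k x0) (P_sums_to n x0).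
by rewrite mulr1 /Psum; case: hs => _ ->.
Qed.

Definition dif a k : R := a k.+1 - a k.

Lemma dif_bnd a M : bseq a M -> bseq (dif a) (2 * M).
Proof.
move=> aM k; rewrite (le_trans (ler_normB _ _))//.
by have := aM k; have := aM k.+1; lra.
Qed.

Lemma hcoef_diffs n a :
  pseries_diffs (hcoef n a) = fun k => n.+1%:R * hcoef n.+1 (fun j => a j.+1) k.
Proof.
apply/funext => k; rewrite /pseries_diffs /hcoef.
have := mul_bin_left (n + k.+1) k; rewrite addnS -addSn addnK.
move=> /(congr1 (fun m => m%:R : R)); rewrite !natrM => e.
by rewrite !mulrA e.
Qed.

(** Termwise differentiation of the power series in y = x / (1 + x); the factor
    (1 + x)^-(n+1) is absorbed by Pascal's rule. Iterating it keeps the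
    coefficients bounded, which is why only bounded sequences ever occur. *)
Lemma is_derive_Psum n a M x : bseq a M -> - 2^-1 < x ->
  is_derive x 1 (Psum n.+1 a) (n.+1%:R * Psum n.+2 (dif a) x).
Proof.
move=> aM hx; have x1 : 0 < 1 + x by lra.
have x1' : 1 + x != 0 by rewrite lt0r_neq0.
pose y : R := x / (1 + x); have y1 := ratio_lt1 hx; rewrite -/y in y1.
pose K : R := (1 + `|y|) / 2.
have K0 : 0 <= K by rewrite /K; have := normr_ge0 y; lra.
have K1 : `|K| < 1 by rewrite ger0_norm// /K; lra.
have aM1 : bseq (fun j => a j.+1) M by move=> k; exact: aM.
have aM2 : bseq (fun j => a j.+2) M by move=> k; exact: aM.
have D : is_derive y 1 (fun z => limn (pseries (hcoef n a) z))
    (limn (pseries (pseries_diffs (hcoef n a)) y)).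
  apply: (@pseries_snd_diffs _ _ K).
  - exact: cvg_hcoef aM K1.
  - rewrite hcoef_diffs.
    have [c _] := sums_toZ n.+1%:R (sums_to_cvg (@cvg_hcoef n.+1 _ _ _ aM1 K1)).
    by rewrite /pseries; under eq_fun do rewrite -mulrA.
  - have -> : pseries_diffs (pseries_diffs (hcoef n a)) =
        fun k => n.+1%:R * (n.+2%:R * hcoef n.+2 (fun j => a j.+2) k).
      rewrite hcoef_diffs; apply/funext => k; rewrite {1}/pseries_diffs mulrCA.
      by congr (_ * _); have := congr1 (fun f => f k) (hcoef_diffs n.+1 (fun j => a j.+1)).
    have [c _] := sums_toZ n.+1%:R (sums_toZ n.+2%:R (sums_to_cvg (@cvg_hcoef n.+2 _ _ _ aM2 K1))).
    by rewrite /pseries; under eq_fun do rewrite -2!mulrA.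
  - by rewrite (ger0_norm K0) /K; lra.
have Dy : is_derive x 1 (fun z : R => z / (1 + z)) ((1 + x)^-1 ^+ 2).
  apply: is_derive_eq. by rewrite /GRing.scale/=; field.
have Dp : is_derive x 1 (fun z : R => (1 + z)^-1 ^+ n.+1)
    (- (n.+1%:R * (1 + x)^-1 ^+ n.+2)).
  have -> : (fun z : R => (1 + z)^-1 ^+ n.+1) = (fun z : R => (1 + z)^-1) ^+ n.+1.
    by apply/funext => z; rewrite fctE.
  have Di : is_derive x 1 (fun z : R => (1 + z)^-1) (- (1 + x)^-1 ^+ 2).
    by apply: is_derive_eq; rewrite /GRing.scale/= exprVn; ring.
  by apply: is_derive_eq; rewrite /GRing.scale/= !exprS; ring.
have Dc := @is_derive1_comp _ _ (fun z : R => z / (1 + z)) _ _ _ D Dy.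
have near_S : \near x, (1 + x)^-1 ^+ n.+1 * limn (pseries (hcoef n a) (x / (1 + x))) = Psum n.+1 a x.
  near=> z; rewrite (Psum_pseriesE n aM)//; near: z.
  by apply: lt_nbhsr.
apply: near_eq_is_derive near_S _.
set A0 := fun z => limn _ in D Dc *; set A1 := limn _ in D Dc.
have sa := sums_to_cvg (@cvg_hcoef n _ _ _ aM y1).
have sb := sums_to_cvg (@cvg_hcoef n.+1 _ _ _ aM y1).
have sa1 := sums_to_cvg (@cvg_hcoef n.+1 _ _ _ aM1 y1).
set B := limn _ in sb; set A2 := limn _ in sa1.
have A1E : A1 = n.+1%:R * A2.
  rewrite /A1 hcoef_diffs; apply: (proj2 (_ : sums_to _ _)).
  by apply: (sums_to_eq (sums_toZ n.+1%:R sa1)) => k; rewrite mulrA.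
have BE : B - A0 y = y * A2.
  have h := sums_toZ y sa1.
  apply: sums_to_uniq (sums_toB sb sa) _; rewrite -[y * A2]add0r.
  have -> : 0 = hcoef n.+1 a 0 * y ^+ 0 - hcoef n a 0 * y ^+ 0 by rewrite /hcoef !bin0 subrr.
  apply/sums_to_shift; apply: (sums_to_eq h) => k.
  by rewrite /hcoef /= addSn !addnS [in X in X - _]binS natrD exprS; ring.
have dE : limn (pseries (hcoef n.+1 (dif a)) y) = A2 - B.
  apply: (proj2 (_ : sums_to _ _)); apply: (sums_to_eq (sums_toB sa1 sb)) => k.
  by rewrite /hcoef /dif /=; ring.
apply: is_derive_eq.
rewrite (Psum_pseriesE n.+1 (dif_bnd aM) hx) -/y dE A1E /GRing.scale/=.
have -> : B = A0 y + y * A2 by rewrite -BE subrKC.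
rewrite -/(A0 y); move: (A0 y) => A.
have -> : y = 1 - (1 + x)^-1 by rewrite /y; field.
move: ((1 + x)^-1) => q; rewrite !exprS; ring.
Unshelve. all: by end_near. Qed.

End Basis.

(** * The operator Dt on Baskakov series *)

Section SumSide.
Context {R : realType}.
Implicit Types (x y t M : R) (n k : nat) (a b : nat -> R).

Definition lapw n k : R := (k * (n + k))%:R.

(** Dt acting on coefficients: the series of Dt (Psum n a) in the basis [P n]
    has the coefficients lap n a. *)
Definition lap n a k : R := lapw n k * (a k.+1 - 2 * a k + a k.-1).

(** Closed form of Dt (Psum n a), obtained by differentiating twice. It makes
    sense for every bounded [a], whereas lap n a may be unbounded. *)
Definition DtPsum n a x : R := (n * n.+1)%:R * psi x * Psum n.+2 (dif (dif a)) x.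

Lemma ltNh0 x : 0 <= x -> - 2^-1 < x. Proof. lra. Qed.

Lemma onep_neq0 x : - 2^-1 < x -> 1 + x != 0.
Proof. by move=> hx; rewrite lt0r_neq0//; lra. Qed.

Lemma DtPsum_sums_to n a M x : bseq a M -> - 2^-1 < x ->
  sums_to (fun k => lap n a k * P n k x) (DtPsum n a x).
Proof.
move=> aM hx; have h := Psum_sums_to n.+1 (dif_bnd (dif_bnd aM)) hx.
have {}h := sums_toZ ((n * n.+1)%:R * psi x) h.
rewrite -[DtPsum n a x]add0r.
have -> : 0 = lap n a 0 * P n 0 x by rewrite /lap /lapw mul0n !mul0r.
apply/sums_to_shift; apply: (sums_to_eq h) => k.
have e := P_psi n k (onep_neq0 hx).
transitivity (dif (dif a) k * ((k.+1 * (n + k.+1))%:R * P n k.+1 x)); first by rewrite e; ring.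
by rewrite /lap /lapw /dif /=; ring.
Qed.

Lemma DtPsum_lap n a M K x : bseq a M -> bseq (lap n.+1 a) K -> - 2^-1 < x ->
  DtPsum n.+1 a x = Psum n.+1 (lap n.+1 a) x.
Proof. by move=> aM lK hx; exact: sums_to_uniq (DtPsum_sums_to n.+1 aM hx) (Psum_sums_to n lK hx). Qed.

Lemma lapwP_sums_to n x : 0 <= x -> sums_to (fun k => lapw n k * P n k x) ((n * n.+1)%:R * psi x).
Proof.
move=> x0; rewrite -[X in sums_to _ X]add0r.
have -> : 0 = lapw n 0 * P n 0 x by rewrite /lapw mul0n mul0r.
apply/sums_to_shift; have := sums_toZ ((n * n.+1)%:R * psi x) (P_sums_to n.+1 x0).
by rewrite mulr1 => h; apply: (sums_to_eq h) => k; rewrite /lapw (P_psi n k (onep_neq0 (ltNh0 x0))).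
Qed.

Lemma kP_sums_to n x : 0 <= x -> sums_to (fun k => k%:R * P n k x) (n%:R * x).
Proof.
move=> x0; rewrite -[X in sums_to _ X]add0r.
have -> : 0 = 0%:R * P n 0 x by rewrite mul0r.
apply/sums_to_shift; have := sums_toZ (n%:R * x) (P_sums_to n x0).
by rewrite mulr1 => h; apply: (sums_to_eq h) => k; rewrite P_recl.
Qed.

Lemma k2P_sums_to n x : 0 <= x ->
  sums_to (fun k => (k%:R - n.+1%:R * x) ^+ 2 * P n.+1 k x) (n.+1%:R * psi x).
Proof.
move=> x0.
have h := sums_toD (sums_toB (lapwP_sums_to n.+1 x0) (sums_toZ (n.+1%:R + 2 * n.+1%:R * x) (kP_sums_to n.+1 x0)))
  (sums_toZ (n.+1%:R ^+ 2 * x ^+ 2) (P_sums_to n x0)).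
have <- : (n.+1 * n.+2)%:R * psi x - (n.+1%:R + 2 * n.+1%:R * x) * (n.+1%:R * x) +
   n.+1%:R ^+ 2 * x ^+ 2 * 1 = n.+1%:R * psi x.
  rewrite /psi natrM -[n.+2%:R]natr1; ring.
by apply: (sums_to_eq h) => k; rewrite /lapw natrM natrD; ring.
Qed.

(** Dt (P n k), by P_psi applied to the second difference of the P n.+2 j. At
    k = 0 the predecessor is harmless because lapw n 0 = 0. *)
Definition DtP n k x : R :=
  lapw n k.-1 * P n k.-1 x - 2 * (lapw n k * P n k x) + lapw n k.+1 * P n k.+1 x.

(** Summation by parts; no boundary terms appear because lapw n 0 = 0 and the
    lapw n k * P n k x are summable. *)
Lemma DtPsum_parts n a M x : bseq a M -> 0 <= x -> sums_to (fun k => a k * DtP n k x) (DtPsum n a x).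
Proof.
move=> aM x0; have hx := ltNh0 x0; pose e k : R := lapw n k * P n k x.
have e0 k : 0 <= e k by rewrite mulr_ge0 ?P_ge0// /lapw ler0n.
have e00 : e 0%N = 0 by rewrite /e /lapw mul0n mul0r.
have he := lapwP_sums_to n x0.
have [s1 h1 _] := sums_to_bounded (fun k => aM k.+1) e0 he.
have [s0 h0 _] := sums_to_bounded aM e0 he.
have [sm hm _] := sums_to_bounded (fun k => aM k.-1) e0 he.
have -> : DtPsum n a x = s1 - 2 * s0 + sm.
  apply: sums_to_uniq (DtPsum_sums_to n aM hx) _.
  by apply: (sums_to_eq (sums_toD (sums_toB h1 (sums_toZ 2 h0)) hm)) => k; rewrite /lap -/(e k) /e; ring.
have h1' : sums_to (fun k => a k * e k.-1) s1.
  rewrite -[s1]add0r.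
  have -> : 0 = a 0%N * e 0%N.-1 by rewrite e00 mulr0.
  by apply/sums_to_shift; apply: (sums_to_eq h1).
have hm' : sums_to (fun k => a k * e k.+1) sm.
  apply/(sums_to_shift (fun k => a k.-1 * e k)); by rewrite e00 mulr0 add0r.
by apply: (sums_to_eq (sums_toD (sums_toB h1' (sums_toZ 2 h0)) hm')) => k; rewrite /DtP -!/(e _); ring.
Qed.

(** The quotient Dt (P n k) / P n k as a polynomial in y = k. The same quotient
    gives the kernels of the functionals lap n (v n ^~ f), see lap_kernelE. *)
Definition DtP_ratio n x y : R :=
  ((y - n%:R * x) ^+ 2 - (1 + 2 * x) * (y - n%:R * x) - n%:R * psi x) / psi x.

Lemma DtP_ratioE n k x : 0 < x -> DtP n k x = DtP_ratio n x k%:R * P n k x.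
Proof.
move=> x0; have x1 : 1 + x != 0 by rewrite lt0r_neq0//; lra.
have xn : x != 0 by rewrite lt0r_neq0.
have up j : lapw n j.+1 * P n j.+1 x = (n + j.+1)%:R * ((n + j)%:R * x / (1 + x) * P n j x).
  have := P_recr n j x1 => e.
  rewrite /lapw natrM mulrAC P_recl mulrC; congr (_ * _).
  transitivity (x / (1 + x) * ((n + j)%:R * P n j x)); last by ring.
  by rewrite e; field.
rewrite /DtP; have -> : lapw n k.-1 * P n k.-1 x = (k%:R - 1) * k%:R * (1 + x) / x * P n k x.
  case: k => [|k] /=; first by rewrite /lapw mul0n !mul0r mulr0 !mul0r.
  have := P_recr n k x1; have := P_recl n k x => e1 e2.
  rewrite /lapw natrM -[LHS]mulrA e2 -[k.+1%:R]natr1 addrK.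
  rewrite natr1; transitivity (k%:R * (1 + x) / x * (k.+1%:R * P n k.+1 x)); last by ring.
  by rewrite e1; field.
rewrite up /lapw natrM !natrD -[k.+1%:R]natr1 /DtP_ratio /psi; field.
by rewrite x1 xn.
Qed.

(** With d = y - n x, the linear term (1 + 2x) |d| / psi x is at most half of
    d^2 / psi x + (1 + 2x)^2 / psi x, and (1 + 2x)^2 = 4 psi x + 1. Only second
    moments and the integral of 1 / psi are needed afterwards. *)
Lemma DtP_ratio_bound n x y : 0 < x ->
  `|DtP_ratio n x y| <= 3 / 2 * ((y - n%:R * x) ^+ 2 / psi x) + (n%:R + 2) + 2^-1 / psi x.
Proof.
move=> x0; have p0 : 0 < psi x by rewrite mulr_gt0//; lra.
rewrite /DtP_ratio normrM normfV (gtr0_norm p0) ler_pdivrMr//.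
set d := y - _.
have -> : (3 / 2 * (d ^+ 2 / psi x) + (n%:R + 2) + 2^-1 / psi x) * psi x =
  3 / 2 * d ^+ 2 + n%:R * psi x + 2^-1 * (4 * psi x + 1) by field; rewrite lt0r_neq0.
have n0 : 0 <= n%:R * psi x by rewrite mulr_ge0// ltW.
have := sqr_ge0 (d - (1 + 2 * x)); have := sqr_ge0 (d + (1 + 2 * x)).
rewrite ler_norml; move: n0; rewrite /psi !expr2; nra.
Qed.

(** With N = n + 1: near 0, where N x <= 1, the factor psi x is at most 2 / N and
    the trivial bound 4 M of the second difference is enough. For N x > 1 one
    has 1 / psi x <= N, and the second moment N psi x of k - N x controls the
    sum of the |DtP N k x|. *)
Lemma bernstein_sum n a M x : bseq a M -> 0 <= x -> `|DtPsum n.+1 a x| <= 16 * n.+1%:R * M.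
Proof.
move=> aM x0; have M0 : 0 <= M by exact: le_trans (normr_ge0 _) (aM 0%N).
have p0 : 0 <= psi x by rewrite mulr_ge0//; lra.
have n1 : 1 <= n.+1%:R :> R by rewrite ler1n.
have [nx|nx] := leP (n.+1%:R * x) 1.
  rewrite /DtPsum normrM (ger0_norm (_ : 0 <= _%:R * psi x)) ?mulr_ge0//; last by lra.
  have h := Psum_bnd n.+2 (dif_bnd (dif_bnd aM)) x0.
  apply: le_trans (ler_wpM2l _ h) _; first by rewrite mulr_ge0.
  rewrite natrM -[n.+2%:R]natr1 /psi.
  have : x <= 1 by nra.
  move: (n.+1%:R : R) n1 nx => N n1 nx x1.
  have -> : N * (N + 1) * (x * (1 + x)) * (2 * (2 * M)) = 4 * M * ((N * x) * ((N + 1) * (1 + x))) by ring.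
  have -> : 16 * N * M = 4 * M * (4 * N) by ring.
  apply: ler_wpM2l; first by lra.
  apply: (@le_trans _ _ (1 * ((N + 1) * (1 + x)))); last by nra.
  by apply: ler_wpM2r nx; rewrite mulr_ge0//; lra.
have xp : 0 < x by nra.
have pp : 0 < psi x by rewrite mulr_gt0//; lra.
have ip : (psi x)^-1 <= n.+1%:R.
  rewrite -[_^-1]mul1r ler_pdivrMr// /psi mulrA mulrDr mulr1.
  have := mulr_ge0 (ltW (lt_trans ltr01 nx)) x0; lra.
have k2 := sums_toZ (3 / 2 / psi x) (k2P_sums_to n x0).
have h := sums_toD k2 (sums_toZ (n.+1%:R + 2 + 2^-1 / psi x) (P_sums_to n x0)).
have dom k : `|a k * DtP n.+1 k x| <= M * (3 / 2 / psi x *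
    ((k%:R - n.+1%:R * x) ^+ 2 * P n.+1 k x) + (n.+1%:R + 2 + 2^-1 / psi x) * P n.+1 k x).
  rewrite normrM; apply: ler_pM => //.
  rewrite DtP_ratioE// normrM (ger0_norm (P_ge0 _ _ x0)).
  apply: le_trans (ler_wpM2r (P_ge0 _ _ x0) (DtP_ratio_bound _ _ xp)) _.
  by rewrite le_eqVlt; apply/orP; left; apply/eqP; ring.
have [s hs le] := sums_to_dom dom (sums_toZ M h).
rewrite (sums_to_uniq (DtPsum_parts n.+1 aM x0) hs); apply: (le_trans le).
have -> : 16 * n.+1%:R * M = M * (16 * n.+1%:R) by ring.
apply: ler_wpM2l => //.
have -> : 3 / 2 / psi x * (n.+1%:R * psi x) = 3 / 2 * n.+1%:R by field; rewrite lt0r_neq0.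
by lra.
Qed.

(** The hypothesis relating [a] and [b] is the one satisfied by the functionals
    v n.+1 and v n.+2 (v_level). Each P n.+2 k is a combination of P n.+1 k and
    P n.+1 k.+1; after a shift the coefficients differ from [a] by a multiple
    of lap n.+1 a. *)
Lemma Psum_level n a b M K x : bseq a M -> bseq b K -> 0 <= x ->
  (forall k, n.+2%:R * b k = (n.+2 + k)%:R * a k - k%:R * a k.+1) ->
  Psum n.+2 b x = Psum n.+1 a x - (n.+1 * n.+2)%:R^-1 * DtPsum n.+1 a x.
Proof.
move=> aM bK x0 ab; have hx := ltNh0 x0; have x1 := onep_neq0 hx.
have hb := Psum_sums_to n.+1 bK hx.
have h1 : sums_to (fun k => b k * ((n.+1 + k)%:R * P n.+1 k x)) (n.+1%:R * (1 + x) * Psum n.+2 b x).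
  by apply: (sums_to_eq (sums_toZ (n.+1%:R * (1 + x)) hb)) => k; rewrite P_recr//; ring.
have h2 : sums_to (fun k => b k.-1 * (k%:R * P n.+1 k x)) (n.+1%:R * x * Psum n.+2 b x).
  rewrite -[X in sums_to _ X]add0r.
  have -> : 0 = b 0%N.-1 * (0%:R * P n.+1 0 x) by rewrite mul0r mulr0.
  by apply/sums_to_shift; apply: (sums_to_eq (sums_toZ (n.+1%:R * x) hb)) => k; rewrite P_recl/=; ring.
have h3 := sums_toB (Psum_sums_to n aM hx) (sums_toZ (n.+1 * n.+2)%:R^-1 (DtPsum_sums_to n.+1 aM hx)).
apply: (mulfI (_ : (n.+1 * n.+2)%:R != 0 :> R)); first by rewrite pnatr_eq0.
have <- : n.+2%:R * (n.+1%:R * (1 + x) * Psum n.+2 b x - n.+1%:R * x * Psum n.+2 b x) =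
  (n.+1 * n.+2)%:R * Psum n.+2 b x by rewrite natrM; ring.
apply: sums_to_uniq (sums_toZ n.+2%:R (sums_toB h1 h2)) _.
apply: (sums_to_eq (sums_toZ (n.+1 * n.+2)%:R h3)) => k.
have nz : (n.+1 * n.+2)%:R != 0 :> R by rewrite pnatr_eq0.
rewrite mulrBr [X in _ - X = _]mulrA mulfV// mul1r.
case: k => [|k] /=.
  have := ab 0%N; rewrite addn0 mul0r subr0 => /(mulfI (_ : n.+2%:R != 0)) -> //.
  by rewrite /lap /lapw mul0n addn0 natrM; ring.
have e0 := ab k; have e1 := ab k.+1.
transitivity (P n.+1 k.+1 x * ((n.+1 + k.+1)%:R * (n.+2%:R * b k.+1) - k.+1%:R * (n.+2%:R * b k))); last by ring.
rewrite e0 e1 /lap /lapw /= !natrM !natrD -[k.+1%:R]natr1 -[n.+2%:R]natr1 -[n.+1%:R]natr1; ring.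
Qed.

End SumSide.

(** * Integrals over the half-line *)

Section HalfLine.
Context {R : realType}.
Implicit Types (f g : R -> R) (l m c M t : R).
Local Notation mu := (@lebesgue_measure R).
Local Notation D := (`]0, +oo[%classic : set R).

(** As for series, integrability and value are carried together. *)
Definition has_int f l : Prop :=
  mu.-integrable D (EFin \o f) /\ \int[mu]_(t in D) f t = l.

Lemma in_halfline t : D t -> 0 < t. Proof. by rewrite /= in_itv/= andbT. Qed.

Lemma has_int_uniq f l m : has_int f l -> has_int f m -> l = m.
Proof. by move=> [_ <-] [_ <-]. Qed.

Lemma has_int_eq f g l : has_int f l -> (forall t, 0 < t -> f t = g t) -> has_int g l.
Proof.
move=> [fi <-] fg; split.
  by apply: eq_integrable fi => // t /set_mem /in_halfline t0 /=; rewrite fg.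
by apply: eq_Rintegral => t /set_mem /in_halfline t0; rewrite fg.
Qed.

Lemma has_intD f g l m : has_int f l -> has_int g m -> has_int (fun t => f t + g t) (l + m).
Proof.
move=> [fi <-] [gi <-]; split; last by rewrite RintegralD.
by apply: (integrableD _ fi gi); exact: measurable_itv.
Qed.

Lemma has_intZ c f l : has_int f l -> has_int (fun t => c * f t) (c * l).
Proof.
move=> [fi <-]; split; last by rewrite RintegralZl.
by apply: (integrableZl _ c fi); exact: measurable_itv.
Qed.

Lemma has_intB f g l m : has_int f l -> has_int g m -> has_int (fun t => f t - g t) (l - m).
Proof.
move=> hf hg; rewrite -mulN1r; apply: (has_int_eq (has_intD hf (has_intZ (-1) hg))) => t _.
by rewrite mulN1r.
Qed.

Lemma has_int_le f g l m : has_int f l -> has_int g m -> (forall t, 0 < t -> f t <= g t) -> l <= m.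
Proof.
by move=> [fi <-] [gi <-] fg; apply: le_Rintegral => // t /in_halfline; exact: fg.
Qed.

Lemma has_int_dom f g m : measurable_fun D f -> (forall t, 0 < t -> `|f t| <= g t) ->
  has_int g m -> exists2 l, has_int f l & `|l| <= m.
Proof.
move=> mf fg gm; have fi : mu.-integrable D (EFin \o f).
  apply: le_integrable (gm.1) => //; first exact/measurable_EFinP.
  move=> t /in_halfline t0 /=; rewrite lee_fin (le_trans (fg _ t0))// ler_norm//.
exists (\int[mu]_(t in D) f t) => //.
rewrite (le_trans (le_normr_Rintegral _ fi))//.
apply: (has_int_le (f := fun t => `|f t|) _ gm fg).
by split => //; exact: integrable_norm.
Qed.

Lemma within_continuousD (A : set R) f g : {within A, continuous f} -> {within A, continuous g} ->
  {within A, continuous (fun x => f x + g x)}.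
Proof.
by move=> cf cg x; exact: (@continuousD _ _ _ (f : subspace A -> R) g x (cf x) (cg x)).
Qed.

Lemma within_continuousM (A : set R) f g : {within A, continuous f} -> {within A, continuous g} ->
  {within A, continuous (fun x => f x * g x)}.
Proof.
by move=> cf cg x; exact: (@continuousM _ _ (f : subspace A -> R) g x (cf x) (cg x)).
Qed.

(** The functions to which the operators are applied, with an explicit bound. *)
Definition bcont f M : Prop :=
  {within `[0, +oo[, continuous f} /\ forall x, 0 <= x -> `|f x| <= M.

Lemma bcont_meas f M : bcont f M -> measurable_fun D f.
Proof.
move=> [/continuous_within_itvcyP[cf _] _].
by apply: open_continuous_measurable_fun => // x /set_mem; exact: cf.
Qed.

Lemma bcont_ge0 f M : bcont f M -> 0 <= M.
Proof. by move=> [_ h]; apply: le_trans (h 0 (lexx _)). Qed.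

Lemma has_int_bcont f g M W l : bcont f M -> measurable_fun D g ->
  (forall t, 0 < t -> `|g t| <= W t) -> has_int W l ->
  exists2 s, has_int (fun t => g t * f t) s & `|s| <= M * l.
Proof.
move=> cf mg gW Wl; apply: has_int_dom (has_intZ M Wl).
  by apply: measurable_funM => //; exact: bcont_meas cf.
move=> t t0; rewrite normrM mulrC; apply: ler_pM => //.
  by apply: cf.2; exact: ltW.
exact: gW.
Qed.

(** The fundamental theorem of calculus on a half-line for an integrable,
    possibly sign-changing, derivative: the case of [0, N] and dominated
    convergence. *)
Lemma has_int_FTC (F f : R -> R) l : (forall x : R, 0 <= x -> is_derive x 1 F (f x)) ->
  {within `[0, +oo[, continuous f} -> mu.-integrable D (EFin \o f) ->
  F x @[x --> +oo] --> l -> has_int f (l - F 0).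
Proof.
move=> dF cf fi Fl; split=> //.
have e N : (\int[mu]_(x in D) (f \_ `[0, N.+1%:R] x)%:E = (F N.+1%:R - F 0)%:E)%E.
  have -> : (\int[mu]_(x in D) (f \_ `[0, N.+1%:R] x)%:E =
     \int[mu]_(x in `]0%R, N.+1%:R]) (f x)%:E)%E.
    have -> : `]0%R, N.+1%:R]%classic = D `&` `[0, N.+1%:R].
      apply/seteqP; split=> x /=; rewrite !in_itv/= andbT.
        by move=> /andP[x0 xN]; rewrite x0 xN ltW.
      by move=> [x0 /andP[_ xN]]; rewrite x0.
    rewrite [RHS]integral_mkcondr; apply: eq_integral => x _.
    by have := congr1 (fun h => h x) (restrict_EFin f `[0, N.+1%:R]%classic).
  rewrite integral_itv_obnd_cbnd; last first.
    apply: measurable_funS (measurable_int _ fi) => //.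
    by move=> x /=; rewrite !in_itv/= => /andP[->].
  rewrite (@continuous_FTC2 _ f F) ?ltr0n//.
  - by apply: continuous_subspaceW cf => x /=; rewrite !in_itv/= => /andP[->].
  - have cF x : 0 <= x -> {for x, continuous F}.
      move=> x0; apply/differentiable_continuous/derivable1_diffP.
      by have [] := dF x x0.
    split.
    + by move=> x /[!in_itv]/= /andP[/ltW x0 _]; have [] := dF x x0.
    + by apply: cvg_at_right_filter; exact: cF.
    + by apply: cvg_at_left_filter; exact: cF.
  - by move=> x /[!in_itv]/= /andP[/ltW x0 _]; have [_] := dF x x0; rewrite derive1E.
have mf : measurable_fun D f by apply/measurable_EFinP; exact: measurable_int fi.
have c1 : (\int[mu]_(x in D) (f \_ `[0, N.+1%:R] x)%:E)%E @[N --> \oo] -->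
    (\int[mu]_(x in D) (f x)%:E)%E.
  apply: (@dominated_cvg _ _ _ mu D _ _ _ (fun x => `|f x|%:E)) => //.
  - move=> N; apply/measurable_EFinP.
    have mA : measurable (`[0, N.+1%:R]%classic : set R) by [].
    have mfA : measurable_fun (D `&` `[0, N.+1%:R]) f by exact: measurable_funS mf.
    exact: (measurable_restrict f mA (measurable_itv _)).1 mfA.
  - move=> x /in_halfline x0; apply: cvg_near_cst; near=> N.
    rewrite patchE mem_set//= in_itv/= (ltW x0)/=.
    near: N; apply: filterS (nbhs_infty_ger x) => N xN; rewrite (le_trans xN)// ler_nat//.
  - by have := integrable_norm fi.
  - move=> N x _; rewrite lee_fin patchE; case: ifPn => // _.
    by rewrite normr0.
have c2 : (F N.+1%:R - F 0)%:E @[N --> \oo] --> (l - F 0)%:E.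
  apply: cvg_EFin; first exact: nearW.
  apply: cvgB; last exact: cvg_cst.
  apply: ((cvg_pinftyP F l).1 Fl); apply/cvgryPge => r; near=> N.
  by near: N; apply: filterS (nbhs_infty_ger r) => N rN; rewrite (le_trans rN)// ler_nat.
rewrite /Rintegral; suff -> : (\int[mu]_(x in D) (f x)%:E = (l - F 0)%:E)%E by [].
rewrite (funext e) in c1; exact: (cvg_unique (@ereal_hausdorff R) c1 c2).
Unshelve. all: by end_near. Qed.

End HalfLine.

(** * Integrals of the basis functions *)

Section Kernels.
Context {R : realType}.
Implicit Types (f g h : R -> R) (l m c M t x : R) (n k : nat).
Local Notation mu := (@lebesgue_measure R).
Local Notation D := (`]0, +oo[%classic : set R).

Lemma P_Psum n k x : - 2^-1 < x -> P n.+1 k x = Psum n.+1 (fun j => (j == k)%:R) x.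
Proof.
move=> hx; have b : bseq (fun j => (j == k)%:R : R) 1.
  by move=> j; case: (j == k); rewrite ?normr1 ?normr0.
exact: sums_to_uniq (sums_to_delta (fun j => P n.+1 j x) k) (Psum_sums_to n b hx).
Qed.

(** The derivative of P n k, with P n.+1 (-1) read as 0. *)
Definition Pderiv n k x : R := n%:R * ((if k is k'.+1 then P n.+1 k' x else 0) - P n.+1 k x).

Lemma is_derive_P n k x : - 2^-1 < x -> is_derive x 1 (P n.+1 k : R -> R) (Pderiv n.+1 k x).
Proof.
move=> hx; have b : bseq (fun j => (j == k)%:R : R) 1.
  by move=> j; case: (j == k); rewrite ?normr1 ?normr0.
have near_P : \near x, Psum n.+1 (fun j => (j == k)%:R) x = P n.+1 k x.
  near=> z; rewrite P_Psum//; near: z; exact: lt_nbhsr.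
apply: near_eq_is_derive near_P _; apply: is_derive_eq (is_derive_Psum n b hx) _.
rewrite /Pderiv; congr (_ * _); apply: sums_to_uniq (Psum_sums_to n.+1 (dif_bnd b) hx) _.
have h2 := sums_to_delta (fun j => P n.+2 j x) k.
case: k b h2 => [|k] b h2.
  rewrite sub0r -mulN1r; apply: (sums_to_eq (sums_toZ (-1) h2)) => j.
  by rewrite /dif; case: j => [|j] /=; ring.
have h1 := sums_to_delta (fun j => P n.+2 j x) k.
by apply: (sums_to_eq (sums_toB h1 h2)) => j; rewrite /dif eqSS; ring.
Unshelve. all: by end_near. Qed.

Lemma cts_P n k x : - 2^-1 < x -> {for x, continuous (P n.+1 k : R -> R)}.
Proof.
move=> hx; apply/differentiable_continuous/derivable1_diffP.
by have [] := is_derive_P n k hx.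
Qed.

Lemma cts_Pderiv n k x : - 2^-1 < x -> {for x, continuous (Pderiv n.+1 k : R -> R)}.
Proof.
move=> hx; apply: continuousM; first exact: cst_continuous.
apply: continuousB; last exact: cts_P.
case: k => [|k]; [exact: cst_continuous|exact: cts_P].
Qed.

Lemma cts_within f : (forall x, 0 <= x -> {for x, continuous f}) ->
  {within `[0, +oo[, continuous f}.
Proof.
move=> cf; apply/continuous_within_itvcyP; split.
  by move=> x; rewrite in_itv/= andbT => /ltW; exact: cf.
by apply: cvg_at_right_filter; exact: cf.
Qed.

Lemma meas_P n k : measurable_fun D (P n.+1 k).
Proof.
apply: open_continuous_measurable_fun => // x /set_mem /in_halfline x0.
by apply: cts_P; lra.
Qed.

Lemma P_decay n k x : 0 <= x -> P n.+1 k x <= 'C(n + k, k)%:R / (1 + x).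
Proof.
move=> x0; have x1 : 0 < 1 + x by lra.
rewrite /P addSn /= -mulrA ler_wpM2l//.
rewrite exprS invfM mulrCA ger_pMr ?invr_gt0//.
rewrite ler_pdivrMr ?exprn_gt0// mul1r exprD.
apply: (@le_trans _ _ (1 * (1 + x) ^+ k)).
  by rewrite mul1r lerXn2r// ?nnegrE; lra.
apply: ler_wpM2r; first by rewrite exprn_ge0// ltW.
by apply: exprn_ege1; lra.
Qed.

Lemma inv1x_cvg0 c : c / (1 + x) @[x --> +oo] --> (0 : R).
Proof.
rewrite -(mulr0 c); apply: cvgMl_tmp.
apply/cvgrPdist_le => e e0; near=> x.
have x0 : 0 < x by near: x; exact: nbhs_pinfty_gt.
have xe : e^-1 < x by near: x; apply: nbhs_pinfty_gt; rewrite num_real.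
rewrite sub0r normrN gtr0_norm ?invr_gt0; last by lra.
by rewrite invf_ple ?posrE//; lra.
Unshelve. all: by end_near. Qed.

Lemma P_cvg0 n k : P n.+1 k x @[x --> +oo] --> (0 : R).
Proof.
apply: squeeze_cvgr (cvg_cst 0) (inv1x_cvg0 'C(n + k, k)%:R).
near=> x; have x0 : 0 <= x by near: x; exact: nbhs_pinfty_ge.
by rewrite P_ge0//= P_decay.
Unshelve. all: by end_near. Qed.

Lemma P_at0 n k : P n k 0 = (k == 0%N)%:R :> R.
Proof.
case: k => [|k]; last by rewrite /P exprS mul0r mulr0 mul0r.
by rewrite /P bin0 addr0 expr0 expr1n invr1 !mulr1.
Qed.

(** Up to the factor - 1/(n+1), the primitive is the sum of the P n.+1 j for
    j <= k, whose derivative telescopes. *)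
Lemma P_primitive n k : exists F : R -> R,
  [/\ forall x, 0 <= x -> is_derive x 1 F (P n.+2 k x), F 0 = - n.+1%:R^-1
    & F x @[x --> +oo] --> (0 : R)].
Proof.
have n0 : n.+1%:R != 0 :> R by rewrite pnatr_eq0.
elim: k => [|k [F [dF F0 Fl]]].
  exists (fun x => - n.+1%:R^-1 * P n.+1 0 x); split=> [x x0||].
  - have dP := is_derive_P n 0 (ltNh0 x0).
    by apply: is_derive_eq; rewrite /GRing.scale/= /Pderiv; field.
  - by rewrite P_at0 mulr1.
  - by rewrite -(mulr0 (- n.+1%:R^-1)); apply: cvgMl_tmp; exact: P_cvg0.
exists (fun x => F x - n.+1%:R^-1 * P n.+1 k.+1 x); split=> [x x0||].
- have dP := is_derive_P n k.+1 (ltNh0 x0); have dFx := dF x x0.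
  by apply: is_derive_eq; rewrite /GRing.scale/= /Pderiv; field.
- by rewrite F0 P_at0 mulr0 subr0.
- rewrite -[0 in X in _ --> X](subr0 0) -[0 in X in _ - X](mulr0 n.+1%:R^-1).
  by apply: cvgB Fl _; apply: cvgMl_tmp; exact: P_cvg0.
Qed.

Lemma has_int_P n k : has_int (P n.+2 k : R -> R) n.+1%:R^-1.
Proof.
have [F [dF F0 Fl]] := P_primitive n k.
have c : {within `[0, +oo[, continuous (P n.+2 k : R -> R)}.
  by apply: cts_within => x x0; apply: cts_P; exact: ltNh0.
have <- : 0 - F 0 = n.+1%:R^-1 by rewrite F0 opprK add0r.
apply: has_int_FTC => //.
have pos (x : R) : 0 <= x -> 0 <= P n.+2 k x by exact: P_ge0.
suff h : mu.-integrable `[0, +oo[ (EFin \o (P n.+2 k : R -> R)).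
  by apply: (integrableS _ _ _ h) => // x; rewrite /= !in_itv/= !andbT => /ltW.
apply/integrableP; split.
  apply/measurable_EFinP; exact: subspace_continuous_measurable_fun.
have -> : (\int[mu]_(x in `[0%R, +oo[) `|(EFin \o P n.+2 k) x| =
    \int[mu]_(x in `[0%R, +oo[) (P n.+2 k x)%:E)%E.
  apply: eq_integral => x /set_mem; rewrite /= in_itv/= andbT => x0.
  by rewrite ger0_norm ?pos.
rewrite (ge0_continuous_FTC2y pos c Fl) ?ltry//.
- by move=> x x0; have [] := dF x (ltW x0).
- apply: cvg_at_right_filter; apply/differentiable_continuous/derivable1_diffP.
  by have [] := dF 0 (lexx _).
- by move=> x; rewrite in_itv/= andbT => /ltW x0; have [_] := dF x x0; rewrite derive1E.
Qed.

(** Integration by parts against a basis function; the boundary term at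
    infinity vanishes because P n.+1 k tends to 0 and [h] is bounded. *)
Lemma has_int_parts n k (h h1 : R -> R) M l m :
  (forall x : R, 0 <= x -> is_derive x 1 h (h1 x)) -> {within `[0, +oo[, continuous h1} ->
  (forall x, 0 <= x -> `|h x| <= M) ->
  has_int (fun t => P n.+1 k t * h1 t) l -> has_int (fun t => Pderiv n.+1 k t * h t) m ->
  l + m = - (P n.+1 k 0 * h 0).
Proof.
move=> dh ch1 hM hl hm.
have ch x : 0 <= x -> {for x, continuous h}.
  move=> x0; apply/differentiable_continuous/derivable1_diffP; by have [] := dh x x0.
pose F x := P n.+1 k x * h x; pose f x := P n.+1 k x * h1 x + Pderiv n.+1 k x * h x.
have hf : has_int f (l + m) by exact: has_intD.
suff : has_int f (0 - F 0) by rewrite sub0r => /(has_int_uniq hf).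
apply: has_int_FTC hf.1 _.
- move=> x x0; have dP := is_derive_P n k (ltNh0 x0); have dhx := dh x x0.
  by apply: is_derive_eq; rewrite /GRing.scale/= /f; ring.
- apply: within_continuousD; apply: within_continuousM.
  + by apply: cts_within => x x0; apply: cts_P; exact: ltNh0.
  + exact: ch1.
  + by apply: cts_within => x x0; apply: cts_Pderiv; exact: ltNh0.
  + exact: cts_within.
- have MP0 : M * P n.+1 k x @[x --> +oo] --> M * 0 by apply: cvgMl_tmp; exact: P_cvg0.
  have MP0' : - M * P n.+1 k x @[x --> +oo] --> - M * 0 by apply: cvgMl_tmp; exact: P_cvg0.
  rewrite mulr0 in MP0; rewrite mulr0 in MP0'.
  apply: squeeze_cvgr MP0' MP0; near=> x.
  have x0 : 0 <= x by near: x; exact: nbhs_pinfty_ge.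
  have := hM x x0; have := P_ge0 n.+1 k x0; rewrite /F ler_norml => p /andP[h0 h2].
  rewrite (mulrC (- M)) (mulrC M); by apply/andP; split; apply: ler_wpM2l.
Unshelve. all: by end_near. Qed.

End Kernels.

(** * The functionals v *)

Section Functionals.
Context {R : realType}.
Implicit Types (f g h : R -> R) (l m c M t x : R) (n k : nat).
Local Notation mu := (@lebesgue_measure R).
Local Notation D := (`]0, +oo[%classic : set R).

Lemma norm_P_le n k t : 0 < t -> `|P n k t| <= P n k t.
Proof. by move=> t0; rewrite ger0_norm// P_ge0// ltW. Qed.

Lemma has_int_v n k f M : bcont f M ->
  has_int (fun t => P n.+3 k t * f t) (n.+2%:R^-1 * v n.+1 k.+1 f).
Proof.
move=> cf; have [s hs _] := has_int_bcont cf (meas_P n.+2 k) (fun t => @norm_P_le n.+3 k t) (has_int_P n.+1 k).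
have -> : n.+2%:R^-1 * v n.+1 k.+1 f = s by rewrite /v hs.2 mulKf// pnatr_eq0.
by [].
Qed.

Lemma v0E n f M : bcont f M -> v n 0 f = f 0.
Proof.
move=> [/continuous_within_itvcyP[_ c0] _]; exact: (cvg_lim (@Rhausdorff R) c0).
Qed.

Lemma v_bnd n f M : bcont f M -> bseq (fun k => v n.+1 k f) M.
Proof.
move=> cf [|k]; first by rewrite (v0E _ cf); apply: cf.2.
have [s hs] := has_int_bcont cf (meas_P n.+2 k) (fun t => @norm_P_le n.+3 k t) (has_int_P n.+1 k).
rewrite (has_int_uniq hs (has_int_v n k cf)) mulrC normrM normfV (ger0_norm (ler0n _ _)).
by rewrite ler_pM2r// invr_gt0 ltr0n.
Qed.

(** P_succ integrated against [f]. *)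
Lemma v_level n f M k : bcont f M ->
  n.+2%:R * v n.+2 k f = (n.+2 + k)%:R * v n.+1 k f - k%:R * v n.+1 k.+1 f.
Proof.
move=> cf; case: k => [|k]; first by rewrite mul0r subr0 addn0 !(v0E _ cf).
have h1 := has_intB (has_intZ (n.+3 + k)%:R (has_int_v n k cf)) (has_intZ k.+1%:R (has_int_v n k.+1 cf)).
have h2 := has_intZ n.+3%:R (has_int_v n.+1 k cf).
have e := has_int_uniq h2 (has_int_eq h1 _); rewrite mulVKf ?pnatr_eq0// in e.
rewrite e; last first.
  move=> t t0; have := P_succ n.+3 k (onep_neq0 (ltNh0 (ltW t0))) => e'.
  by rewrite [RHS]mulrA e'; ring.
rewrite addnS addSn; have : n.+2%:R != 0 :> R by rewrite pnatr_eq0.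
by move: (n.+2%:R : R) => N N0; field.
Qed.

(** The duality between Dt and lap: two integrations by parts. The only boundary
    term is g 0, and v n 0 is defined so as to absorb it. *)
Lemma v_lap n (g g1 g2 : R -> R) M M1 K k :
  (forall x : R, 0 <= x -> is_derive x 1 g (g1 x)) ->
  (forall x : R, 0 <= x -> is_derive x 1 g1 (g2 x)) ->
  bcont g M -> bcont g1 M1 -> {within `[0, +oo[, continuous g2} ->
  bcont (fun x => psi x * g2 x) K ->
  lap n.+1 (fun j => v n.+1 j g) k = v n.+1 k (fun x => psi x * g2 x).
Proof.
move=> dg dg1 cg cg1 cg2 ck.
have first_diff j : has_int (fun t => P n.+2 j t * g1 t) (v n.+1 j.+1 g - v n.+1 j g).
  have [l hl _] := has_int_bcont cg1 (meas_P n.+1 j) (fun t => @norm_P_le n.+2 j t) (has_int_P n j).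
  have -> : v n.+1 j.+1 g - v n.+1 j g = l; last by [].
  have n2 : n.+2%:R != 0 :> R by rewrite pnatr_eq0.
  case: j hl => [|j] hl.
    have hm : has_int (fun t => Pderiv n.+2 0 t * g t) (- n.+2%:R * (n.+2%:R^-1 * v n.+1 1 g)).
      by apply: (has_int_eq (has_intZ (- n.+2%:R) (has_int_v n 0 cg))) => t _; rewrite /Pderiv; ring.
    have := has_int_parts dg cg1.1 cg.2 hl hm.
    rewrite P_at0 mul1r (v0E _ cg) mulNr mulVKf// => e; lra.
  have hm : has_int (fun t => Pderiv n.+2 j.+1 t * g t)
      (n.+2%:R * (n.+2%:R^-1 * v n.+1 j.+1 g - n.+2%:R^-1 * v n.+1 j.+2 g)).
    apply: (has_int_eq (has_intZ n.+2%:R (has_intB (has_int_v n j cg) (has_int_v n j.+1 cg)))) => t _.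
    by rewrite /Pderiv; ring.
  have := has_int_parts dg cg1.1 cg.2 hl hm.
  by rewrite P_at0 mul0r mulrBr !mulVKf// => e; lra.
case: k => [|k].
  by rewrite /lap /lapw mul0n mul0r (v0E _ ck) /psi !mul0r.
have c0 : (k.+1 * (n.+1 + k.+1))%:R != 0 :> R by rewrite pnatr_eq0 muln_eq0 addnS.
have hl : has_int (fun t => P n.+1 k.+1 t * g2 t)
   ((n.+1 * n.+2)%:R / (k.+1 * (n.+1 + k.+1))%:R * (n.+2%:R^-1 * v n.+1 k.+1 (fun x => psi x * g2 x))).
  apply: (has_int_eq (has_intZ _ (has_int_v n k ck))) => t t0.
  have := P_psi n.+1 k (onep_neq0 (ltNh0 (ltW t0))) => e.
  apply: (mulfI c0); rewrite [in RHS]mulrA e.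
  by move: c0; move: ((k.+1 * (n.+1 + k.+1))%:R : R) ((n.+1 * n.+2)%:R : R) => C E C0; field.
have hm : has_int (fun t => Pderiv n.+1 k.+1 t * g1 t)
   (n.+1%:R * ((v n.+1 k.+1 g - v n.+1 k g) - (v n.+1 k.+2 g - v n.+1 k.+1 g))).
  apply: (has_int_eq (has_intZ n.+1%:R (has_intB (first_diff k) (first_diff k.+1)))) => t _.
  by rewrite /Pderiv; ring.
have := has_int_parts dg1 cg2 cg1.2 hl hm.
rewrite P_at0 mul0r /lap /lapw => e.
move: e; set Vop := v n.+1 k.+1 (fun x => psi x * g2 x) => /eqP.
rewrite oppr0 addr_eq0 => /eqP e.
have N0 : n.+2%:R != 0 :> R by rewrite pnatr_eq0.
have N1 : n.+1%:R != 0 :> R by rewrite pnatr_eq0.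
move: c0 N0 N1 e; rewrite [k.+1.-1]/= (natrM _ n.+1 n.+2).
move: Vop (v n.+1 k.+2 g) (v n.+1 k.+1 g) (v n.+1 k g) => Vop v2 v1 v0.
move: (n.+2%:R : R) (n.+1%:R : R) ((k.+1 * (n.+1 + k.+1))%:R : R) => N N' C C0 N0 N1 e.
apply: (mulfI (_ : N' / C != 0)); first by rewrite mulf_neq0// invr_neq0.
transitivity (N' * N / C * (N^-1 * Vop)); last by field; rewrite C0 N0.
by rewrite e; field.
Qed.

(** t * P n.+1 j t is a multiple of P n j.+1 t by P_recl, so moments are again
    integrals of basis functions. *)
Lemma has_int_quad n j a b c : has_int (fun t => (a + b * t + c * t ^+ 2) * P n.+4 j t)
  (a * n.+3%:R^-1 + b * (j.+1%:R / n.+3%:R * n.+2%:R^-1) +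
   c * (j.+1%:R * j.+2%:R / (n.+3%:R * n.+2%:R) * n.+1%:R^-1)).
Proof.
have h0 := has_intZ a (has_int_P n.+2 j).
have h1 := has_intZ b (has_intZ (j.+1%:R / n.+3%:R) (has_int_P n.+1 j.+1)).
have h2 := has_intZ c (has_intZ (j.+1%:R * j.+2%:R / (n.+3%:R * n.+2%:R)) (has_int_P n j.+2)).
apply: (has_int_eq (has_intD (has_intD h0 h1) h2)) => t _.
have e1 := P_recl n.+3 j t; have e2 := P_recl n.+2 j.+1 t.
have n3 : n.+3%:R != 0 :> R by rewrite pnatr_eq0.
have n2 : n.+2%:R != 0 :> R by rewrite pnatr_eq0.
move: (P n.+2 j.+2 t) (P n.+3 j.+1 t) (P n.+4 j t) e1 e2 => p2 p1 p0.
move: n3 n2; move: (n.+3%:R : R) (n.+2%:R : R) (j.+1%:R : R) (j.+2%:R : R) => A B J1 J2 A0 B0 e1 e2.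
have -> : b * (J1 / A * p1) = b * (t * p0).
  by congr (_ * _); rewrite mulrAC e1; field.
have -> : c * (J1 * J2 / (A * B) * p2) = c * (t ^+ 2 * p0).
  transitivity (c * (J1 / (A * B) * (J2 * p2))); first by ring.
  rewrite e2; transitivity (c * (t / A * (J1 * p1))); first by field; rewrite A0 B0.
  by rewrite e1; field.
by ring.
Qed.

(** Up to the factor n + 2, the left-hand side is the kernel of the functional
    f |-> lap n.+1 (v n.+1 ^~ f) j.+2. By P_psi it is proportional to DtP. *)
Lemma lap_kernelE n j t : 0 < t ->
  lapw n.+1 j.+2 * (P n.+3 j.+2 t - 2 * P n.+3 j.+1 t + P n.+3 j t) =
  DtP_ratio n.+1 t j.+2%:R * P n.+3 j.+1 t.
Proof.
move=> t0; have t1 := onep_neq0 (ltNh0 (ltW t0)).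
have pn : psi t != 0 by rewrite /psi mulf_neq0 // lt0r_neq0.
have z : (n.+1 * n.+2)%:R * psi t != 0 by rewrite mulf_neq0// pnatr_eq0.
have := DtP_ratioE n.+1 j.+2 t0; rewrite /DtP /= {1 3 4}/lapw !P_psi// => e.
apply: (mulfI z).
transitivity (lapw n.+1 j.+2 * (DtP_ratio n.+1 t j.+2%:R * P n.+1 j.+2 t)).
  by rewrite -e /lapw; ring.
by rewrite mulrCA {1}/lapw P_psi//; ring.
Qed.

(** The left-hand side is n + 2 times the integral of the majorant in
    bernstein_int, as has_int_quad produces it. *)
Lemma kernel_integral_le (n j : R) : 0 <= n -> 0 <= j ->
  (n + 2) * (3 / 2 * ((n + 3) * (n + 4) / ((j + 1) * (n + j + 4))) *
    ((j + 2) ^+ 2 * (n + 4)^-1 + - (2 * (j + 2) * (n + 1)) * ((j + 1) / (n + 4) * (n + 3)^-1)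
     + (n + 1) ^+ 2 * ((j + 1) * (j + 2) / ((n + 4) * (n + 3)) * (n + 2)^-1))
   + (n + 1 + 2) * (n + 2)^-1
   + 2^-1 * ((n + 3) * (n + 4) / ((j + 1) * (n + j + 4))) * (n + 4)^-1) <= 16 * (n + 1).
Proof.
move=> n0 j0.
have -> : (n + 2) * (3 / 2 * ((n + 3) * (n + 4) / ((j + 1) * (n + j + 4))) *
    ((j + 2) ^+ 2 * (n + 4)^-1 + - (2 * (j + 2) * (n + 1)) * ((j + 1) / (n + 4) * (n + 3)^-1)
     + (n + 1) ^+ 2 * ((j + 1) * (j + 2) / ((n + 4) * (n + 3)) * (n + 2)^-1))
   + (n + 1 + 2) * (n + 2)^-1
   + 2^-1 * ((n + 3) * (n + 4) / ((j + 1) * (n + j + 4))) * (n + 4)^-1) =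
  (n + 3) * (3 / 2 * ((j + 2) * (n + j + 3) / ((j + 1) * (n + j + 4))) + 1
   + 2^-1 * ((n + 2) / ((j + 1) * (n + j + 4)))).
  field. 
  repeat (apply/andP; split); lra.
have p : 0 < (j + 1) * (n + j + 4) by apply: mulr_gt0; lra.
have b1 : (j + 2) * (n + j + 3) / ((j + 1) * (n + j + 4)) <= 2.
  by rewrite ler_pdivrMr//; nra.
have b2 : (n + 2) / ((j + 1) * (n + j + 4)) <= 1.
  by rewrite ler_pdivrMr//; nra.
apply: (@le_trans _ _ ((n + 3) * (9 / 2))); last by lra.
by apply: ler_wpM2l; lra.
Qed.

(** The counterpart of bernstein_sum on the side of the functionals. For
    k >= 2 the factor 1 / psi of DtP_ratio turns P n.+3 j.+1 into a multiple of
    P n.+5 j, which is integrable; for k <= 1 the weight of the second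
    difference is at most n + 2 and the trivial bound suffices. *)
Lemma bernstein_int n f M : bcont f M -> bseq (lap n.+1 (fun j => v n.+1 j f)) (16 * n.+1%:R * M).
Proof.
move=> cf k; have M0 := bcont_ge0 cf; have b := v_bnd n cf.
have n1 : 1 <= n.+1%:R :> R by rewrite ler1n.
case: k => [|[|j]].
- by rewrite /lap /lapw mul0n mul0r normr0 !mulr_ge0.
- rewrite /lap /lapw mul1n normrM ger0_norm ?ler0n//= addn1.
  have := b 2%N; have := b 1%N; have := b 0%N; rewrite !ler_norml => /andP[? ?] /andP[? ?] /andP[? ?].
  have h : `|v n.+1 2 f - 2 * v n.+1 1 f + v n.+1 0 f| <= 4 * M by rewrite ler_norml; lra.
  apply: le_trans (ler_wpM2l _ h) _ => //; rewrite -[n.+2%:R]natr1.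
  by move: (n.+1%:R : R) n1 => N N1; nra.
set k := j.+2.
pose L := lap n.+1 (fun j => v n.+1 j f) k.
pose K t := lapw n.+1 k * (P n.+3 j.+2 t - 2 * P n.+3 j.+1 t + P n.+3 j t).
have hL : has_int (fun t => K t * f t) (n.+2%:R^-1 * L).
  have h := has_intZ (lapw n.+1 k) (has_intD (has_intB (has_int_v n j.+2 cf) (has_intZ 2 (has_int_v n j.+1 cf))) (has_int_v n j cf)).
  have -> : n.+2%:R^-1 * L = lapw n.+1 k * (n.+2%:R^-1 * v n.+1 j.+3 f - 2 * (n.+2%:R^-1 * v n.+1 j.+2 f)
     + n.+2%:R^-1 * v n.+1 j.+1 f) by rewrite /L /lap /=; ring.
  by apply: (has_int_eq h) => t t0; rewrite /K; ring.
pose ga : R := (n.+3 * n.+4)%:R / (j.+1 * (n.+3 + j.+1))%:R.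
have hW := has_intD (has_intD (has_intZ (3 / 2 * ga) (has_int_quad n.+1 j (k%:R ^+ 2) (- (2 * k%:R * n.+1%:R)) (n.+1%:R ^+ 2)))
  (has_intZ (n.+1%:R + 2) (has_int_P n.+1 j.+1))) (has_intZ (2^-1 * ga) (has_int_P n.+3 j)).
have dom t : 0 < t -> `|K t| <=
   3 / 2 * ga * ((k%:R ^+ 2 + - (2 * k%:R * n.+1%:R) * t + n.+1%:R ^+ 2 * t ^+ 2) * P n.+4.+1 j t)
   + (n.+1%:R + 2) * P n.+3 j.+1 t + 2^-1 * ga * P n.+4.+1 j t.
  move=> t0; have p0 := P_ge0 n.+3 j.+1 (ltW t0).
  have pp : 0 < psi t by rewrite mulr_gt0//; lra.
  rewrite /K lap_kernelE// normrM (ger0_norm p0); apply: le_trans (ler_wpM2r p0 (DtP_ratio_bound _ _ t0)) _.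
  have e : P n.+3 j.+1 t / psi t = ga * P n.+4.+1 j t.
    have c0 : (j.+1 * (n.+3 + j.+1))%:R != 0 :> R by rewrite pnatr_eq0 muln_eq0 addnS.
    apply: (mulfI c0); rewrite mulrA P_psi; last by rewrite lt0r_neq0//; lra.
    rewrite /ga; move: c0 pp; move: ((j.+1 * _)%:R : R) ((n.+3 * _)%:R : R) (psi t) => C E Y C0 Y0.
    by field; rewrite C0 lt0r_neq0.
  rewrite le_eqVlt; apply/orP; left; apply/eqP.
  transitivity (3 / 2 * (j.+2%:R - n.+1%:R * t) ^+ 2 * (P n.+3 j.+1 t / psi t)
    + (n.+1%:R + 2) * P n.+3 j.+1 t + 2^-1 * (P n.+3 j.+1 t / psi t)); first by ring.
  by rewrite e /k; ring.
have mq : measurable_fun D K.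
  apply: measurable_funM => //; apply: measurable_funD; last exact: meas_P.
  apply: measurable_funB; first exact: meas_P.
  by apply: measurable_funM => //; exact: meas_P.
have [s hs ls] := has_int_bcont cf mq dom hW.
have e := has_int_uniq hL hs.
rewrite -/L; have -> : L = n.+2%:R * s by rewrite -e mulVKf// pnatr_eq0.
rewrite normrM ger0_norm ?ler0n//.
apply: le_trans (ler_wpM2l (ler0n _ _) ls) _.
rewrite mulrCA [leRHS]mulrC; apply: ler_wpM2l => //.
have := @kernel_integral_le n%:R j%:R (ler0n _ _) (ler0n _ _).
have -> : n%:R + 1 = n.+1%:R :> R by rewrite natr1.
have -> : n%:R + 2 = n.+2%:R :> R by rewrite -natrD addn2.
have -> : n%:R + 3 = n.+3%:R :> R by rewrite -natrD addn3.
have -> : n%:R + 4 = n.+4%:R :> R by rewrite -natrD addn4.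
have -> : j%:R + 1 = j.+1%:R :> R by rewrite natr1.
have -> : j%:R + 2 = j.+2%:R :> R by rewrite -natrD addn2.
have -> : (n%:R + j%:R + 4) = (n.+3 + j.+1)%:R :> R.
  by ring.
by rewrite /ga !natrM.
Qed.

(** By |t - x| <= (e + (t - x)^2 / e) / 2, the estimate reduces to the second
    moment of the functional, which is explicit. *)
Lemma v_lip n g M (A x e : R) k : bcont g M -> 0 <= A -> 0 <= x -> 0 < e ->
  (forall t, 0 <= t -> `|g t - g x| <= A * `|t - x|) ->
  `|v n.+2 k g - g x| <= A / 2 * (e + (k%:R * k.+1%:R / (n.+2%:R * n.+1%:R)
     - 2 * x * (k%:R / n.+2%:R) + x ^+ 2) / e).
Proof.
move=> cg A0 x0 e0 gl.
have young t : 0 <= t -> `|g t - g x| <= A / 2 * (e + (t - x) ^+ 2 / e).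
  move=> t0; apply: le_trans (gl t t0) _; rewrite -mulrA; apply: ler_wpM2l => //.
  rewrite ler_pdivlMl//.
  have -> : e + (t - x) ^+ 2 / e = (e ^+ 2 + (t - x) ^+ 2) / e by field; rewrite lt0r_neq0.
  rewrite ler_pdivlMr// -subr_ge0 -(real_normK (num_real (t - x))).
  have -> : e ^+ 2 + `|t - x| ^+ 2 - 2 * `|t - x| * e = (e - `|t - x|) ^+ 2 by ring.
  exact: sqr_ge0.
case: k => [|j].
  rewrite (v0E _ cg) !mul0r mulr0 subr0 add0r.
  by have := young 0 (lexx _); rewrite sub0r sqrrN.
have h1 := has_intB (has_int_v n.+1 j cg) (has_intZ (g x) (has_int_P n.+2 j)).
pose a : R := A / 2 * (e + x ^+ 2 / e).
have hq := has_int_quad n j a (- (A * x / e)) (A / 2 / e).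
have mg : measurable_fun D (fun t => P n.+4 j t * g t - g x * P n.+4 j t).
  apply: measurable_funB; apply: measurable_funM => //; try exact: meas_P.
  exact: bcont_meas cg.
have dom t : 0 < t -> `|P n.+4 j t * g t - g x * P n.+4 j t| <=
    (a + (- (A * x / e)) * t + A / 2 / e * t ^+ 2) * P n.+4 j t.
  move=> t0; have p0 := P_ge0 n.+4 j (ltW t0).
  have -> : P n.+4 j t * g t - g x * P n.+4 j t = (g t - g x) * P n.+4 j t by ring.
  rewrite normrM (ger0_norm p0); apply: ler_wpM2r => //.
  apply: le_trans (young t (ltW t0)) _.
  by rewrite le_eqVlt; apply/orP; left; apply/eqP; rewrite /a; field; rewrite lt0r_neq0.
have [s hs ls] := has_int_dom mg dom hq.
have n3 : n.+3%:R != 0 :> R by rewrite pnatr_eq0.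
have -> : v n.+2 j.+1 g - g x = n.+3%:R * s.
  by rewrite (has_int_uniq hs h1); move: (n.+3%:R : R) n3 (v _ _ _) => N3 n3 Vop; field.
rewrite normrM ger0_norm ?ler0n//.
apply: le_trans (ler_wpM2l (ler0n _ _) ls) _.
have n2 : n.+2%:R != 0 :> R by rewrite pnatr_eq0.
have n1 : n.+1%:R != 0 :> R by rewrite pnatr_eq0.
rewrite le_eqVlt; apply/orP; left; apply/eqP; rewrite /a.
move: (n.+3%:R : R) (n.+2%:R : R) (n.+1%:R : R) n3 n2 n1 => N3 N2 N1 n3 n2 n1.
by field; rewrite n1 n2 n3 lt0r_neq0.
Qed.

End Functionals.

(** * The operators and their commutation with Dt *)

Section Operators.
Context {R : realType}.
Implicit Types (f g h : R -> R) (l c M t x : R) (n m k j : nat) (a b : nat -> R).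
Local Notation mu := (@lebesgue_measure R).
Local Notation D := (`]0, +oo[%classic : set R).

(** The operator without the correction term: Vt n f = Vop n f - Dt (Vop n f) / n. *)
Definition Vop n f : R -> R := Psum n (fun k => v n k f).

(** Coefficients of Vt n f in the basis [P n]: by DtPsum_parts the operator Dt in
    the definition of Pt moves onto the functionals. *)
Definition vmod n f k : R := v n k f - n%:R^-1 * lap n (fun j => v n j f) k.

(** This is Vt n f on [0, oo), see Vt_Vmod. *)
Definition Vmod n f : R -> R := Psum n (vmod n f).

Lemma cts_Psum n a M x : bseq a M -> 0 <= x -> {for x, continuous (Psum n.+1 a)}.
Proof.
move=> aM x0; apply/differentiable_continuous/derivable1_diffP.
by have [] := is_derive_Psum n aM (ltNh0 x0).
Qed.

Lemma Psum_bcont n a M : bseq a M -> bcont (Psum n.+1 a) M.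
Proof.
move=> aM; split; last by move=> x; exact: Psum_bnd.
by apply: cts_within => x x0; exact: (cts_Psum aM x0).
Qed.

Lemma cts_psi x : {for x, continuous (psi : R -> R)}.
Proof.
apply: continuousM; first exact: cvg_id.
by apply: continuousD; [exact: cst_continuous|exact: cvg_id].
Qed.

Lemma DtPsum_bcont n a M : bseq a M -> bcont (DtPsum n.+1 a) (16 * n.+1%:R * M).
Proof.
move=> aM; split; last by move=> x; exact: bernstein_sum.
apply: cts_within => x x0; apply: continuousM; last exact: (cts_Psum (dif_bnd (dif_bnd aM)) x0).
by apply: continuousM; [exact: cst_continuous|exact: cts_psi].
Qed.

(** The factor 1/n compensates bernstein_int. Thus Vt n f is a Baskakov series
    with bounded coefficients, to which bernstein_sum applies a second time. *)
Lemma vmod_bnd n f M : bcont f M -> bseq (vmod n.+1 f) (17 * M).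
Proof.
move=> cf k; rewrite /vmod; have h1 := v_bnd n cf k; have h2 := bernstein_int n cf k.
have N0 : 0 < n.+1%:R :> R by rewrite ltr0n.
apply: le_trans (ler_normB _ _) _; rewrite normrM normfV (gtr0_norm N0).
have -> : 17 * M = M + n.+1%:R^-1 * (16 * n.+1%:R * M).
  by move: (n.+1%:R : R) N0 => N N0; field; rewrite lt0r_neq0.
by apply: lerD => //; apply: ler_wpM2l h2; rewrite invr_ge0 ltW.
Qed.

Lemma Vmod_bcont n f M : bcont f M -> bcont (Vmod n.+1 f) (17 * M).
Proof. by move=> cf; apply: Psum_bcont; exact: vmod_bnd. Qed.

(** The functionals see only the values on (0, oo), including the limit at 0. *)
Lemma v_ext n k f g : (forall x, 0 < x -> f x = g x) -> v n k f = v n k g.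
Proof.
move=> fg; case: k => [|k] /=.
  have e : \forall t \near 0^'+, f t = g t.
    by near=> t; apply: fg; near: t; exact: nbhs_right_gt.
  have e' : \forall t \near 0^'+, g t = f t.
    by near=> t; rewrite fg//; near: t; exact: nbhs_right_gt.
  by congr (lim _); apply/seteqP; split; apply: near_eq_cvg.
congr (_ * _); apply: eq_Rintegral => t /set_mem /in_halfline t0; rewrite fg//.
Unshelve. all: by end_near. Qed.

Lemma vmod_ext n f g : (forall x, 0 <= x -> f x = g x) -> vmod n f = vmod n g.
Proof.
move=> fg; have e j : v n j f = v n j g by apply: v_ext => x x0; apply: fg; exact: ltW.
by apply/funext => k; rewrite /vmod /lap !e.
Qed.

Lemma bcontB f g M K : bcont f M -> bcont g K -> bcont (fun x => f x - g x) (M + K).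
Proof.
move=> [cf fM] [cg gK]; split; last first.
  by move=> x x0; apply: le_trans (ler_normB _ _) _; apply: lerD; [exact: fM|exact: gK].
by move=> x; exact: (@continuousB _ _ _ (f : subspace _ -> R) g x (cf x) (cg x)).
Qed.

Lemma vB n k f g M K : bcont f M -> bcont g K ->
  v n.+1 k (fun x => f x - g x) = v n.+1 k f - v n.+1 k g.
Proof.
move=> cf cg; case: k => [|k].
  by rewrite (v0E _ (bcontB cf cg)) (v0E _ cf) (v0E _ cg).
have h := has_intB (has_int_v n k cf) (has_int_v n k cg).
have h2 := has_int_v n k (bcontB cf cg).
have e : n.+2%:R^-1 * v n.+1 k.+1 (fun x => f x - g x) =
   n.+2%:R^-1 * (v n.+1 k.+1 f - v n.+1 k.+1 g).
  by rewrite mulrBr; apply: (has_int_uniq h2); apply: (has_int_eq h) => t _; ring.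
by apply: mulfI e; rewrite invr_neq0// pnatr_eq0.
Qed.

Lemma vmodB n f g M K : bcont f M -> bcont g K ->
  vmod n.+1 (fun x => f x - g x) = fun k => vmod n.+1 f k - vmod n.+1 g k.
Proof.
by move=> cf cg; apply/funext => k; rewrite /vmod /lap !(vB _ _ cf cg); ring.
Qed.

Lemma PsumB n a b M K x : bseq a M -> bseq b K -> 0 <= x ->
  Psum n.+1 (fun k => a k - b k) x = Psum n.+1 a x - Psum n.+1 b x.
Proof.
move=> aM bK x0; apply: (proj2 (_ : sums_to _ _)).
by apply: (sums_to_eq (sums_toB (Psum_sums_to n aM (ltNh0 x0)) (Psum_sums_to n bK (ltNh0 x0)))) => k; ring.
Qed.

Lemma DtPsumB n a b M K x : bseq a M -> bseq b K -> 0 <= x ->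
  DtPsum n (fun k => a k - b k) x = DtPsum n a x - DtPsum n b x.
Proof.
move=> aM bK x0; rewrite /DtPsum -mulrBr -(PsumB _ (dif_bnd (dif_bnd aM)) (dif_bnd (dif_bnd bK)) x0).
by congr (_ * Psum _ _ _); apply/funext => k; rewrite /dif; ring.
Qed.

(** v_lap on the range of the operators, where boundedness of the derivatives
    is automatic. *)
Lemma lap_v_Psum n m b M k : bseq b M ->
  lap n.+1 (fun j => v n.+1 j (Psum m.+1 b)) k = v n.+1 k (DtPsum m.+1 b).
Proof.
move=> bM; have d1 := dif_bnd bM; have d2 := dif_bnd d1.
pose g1 x := m.+1%:R * Psum m.+2 (dif b) x.
pose g2 x := m.+1%:R * (m.+2%:R * Psum m.+3 (dif (dif b)) x).
have e : DtPsum m.+1 b = fun x => psi x * g2 x.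
  by apply/funext => x; rewrite /DtPsum /g2 natrM; ring.
rewrite e; apply: (@v_lap _ _ _ g1 g2 M (m.+1%:R * (2 * M)) (16 * m.+1%:R * M)).
- by move=> x x0; exact: (is_derive_Psum m bM (ltNh0 x0)).
- move=> x x0; have h := is_derive_Psum m.+1 d1 (ltNh0 x0).
  exact: (@is_deriveZ _ _ _ _ _ _ _ _ h).
- exact: Psum_bcont.
- have [c h] := Psum_bcont m.+1 d1; split.
    by apply: within_continuousM => //; apply: continuous_subspaceT => y; exact: cst_continuous.
  by move=> x x0; rewrite /g1 normrM ger0_norm ?ler0n// ler_wpM2l// h.
- have [c _] := Psum_bcont m.+2 d2.
  by apply: within_continuousM; [|apply: within_continuousM => //]; apply: continuous_subspaceT => y; exact: cst_continuous.
- by rewrite -e; exact: DtPsum_bcont.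
Qed.

Lemma DtPsum_v n m b M x : bseq b M -> 0 <= x ->
  DtPsum n.+1 (fun j => v n.+1 j (Psum m.+1 b)) x = Vop n.+1 (DtPsum m.+1 b) x.
Proof.
move=> bM x0; have e : lap n.+1 (fun j => v n.+1 j (Psum m.+1 b)) = fun k => v n.+1 k (DtPsum m.+1 b).
  by apply/funext => k; exact: (lap_v_Psum n m k bM).
rewrite /Vop -e; apply: (DtPsum_lap (v_bnd n (Psum_bcont m bM)) _ (ltNh0 x0)).
by rewrite e; exact: (v_bnd n (DtPsum_bcont m bM)).
Qed.

(** Dt commutes with the modified operators on their range; in particular the
    coefficients on the left are bounded. *)
Lemma lap_vmod n m b M : bseq b M -> lap n.+1 (vmod n.+1 (Psum m.+1 b)) = vmod n.+1 (DtPsum m.+1 b).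
Proof.
move=> bM; have e j := lap_v_Psum n m j bM.
apply/funext => k; rewrite /vmod [in RHS]/lap -!e /lap /=; ring.
Qed.

Lemma DtPsum_vmod n m b M x : bseq b M -> 0 <= x ->
  DtPsum n.+1 (vmod n.+1 (Psum m.+1 b)) x = Vmod n.+1 (DtPsum m.+1 b) x.
Proof.
move=> bM x0; rewrite /Vmod -(lap_vmod n m bM).
apply: (DtPsum_lap (vmod_bnd n (Psum_bcont m bM)) _ (ltNh0 x0)).
by rewrite (lap_vmod n m bM); exact: (vmod_bnd n (DtPsum_bcont m bM)).
Qed.

Lemma Vmod_Vop n f M x : bcont f M -> 0 <= x ->
  Vmod n.+1 f x = Vop n.+1 f x - n.+1%:R^-1 * DtPsum n.+1 (fun j => v n.+1 j f) x.
Proof.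
move=> cf x0; have hx := ltNh0 x0; have b := v_bnd n cf.
apply: sums_to_uniq (Psum_sums_to n (vmod_bnd n cf) hx) _.
by apply: (sums_to_eq (sums_toB (Psum_sums_to n b hx) (sums_toZ n.+1%:R^-1 (DtPsum_sums_to n.+1 b hx)))) => k; rewrite /vmod; ring.
Qed.

(** Vop n.+2 = (1 - Dt / ((n+1)(n+2))) Vop n.+1 : each step down in [n] applies
    one more resolvent of Dt. *)
Lemma Vop_succ n f M x : bcont f M -> 0 <= x ->
  Vop n.+2 f x = Vop n.+1 f x - (n.+1 * n.+2)%:R^-1 * DtPsum n.+1 (fun j => v n.+1 j f) x.
Proof.
move=> cf x0; apply: (Psum_level (v_bnd n cf) (v_bnd n.+1 cf) x0) => k.
exact: (v_level n k cf).
Qed.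

Lemma Psum_lipschitz n b M x t : bseq b M -> 0 <= x -> 0 <= t ->
  `|Psum n.+1 b t - Psum n.+1 b x| <= n.+1%:R * (2 * M) * `|t - x|.
Proof.
move=> bM; wlog xt : x t / x <= t => [H x0 t0|x0 t0].
  case: (leP x t) => [xt|/ltW tx]; first exact: H.
  by rewrite distrC (distrC t); exact: H.
have dS (y : R) : 0 <= y -> is_derive y 1 (Psum n.+1 b) (n.+1%:R * Psum n.+2 (dif b) y).
  by move=> y0; exact: (is_derive_Psum n bM (ltNh0 y0)).
have dS' y : y \in `]x, t[ -> is_derive y 1 (Psum n.+1 b) (n.+1%:R * Psum n.+2 (dif b) y).
  by rewrite in_itv/= => /andP[xy _]; apply: dS; rewrite (le_trans x0)// ltW.
have cS : {within `[x, t], continuous (Psum n.+1 b)}.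
  by apply: continuous_subspaceW (Psum_bcont n bM).1 => y /=; rewrite !in_itv/= => /andP[/(le_trans x0) ->].
have [y + e] := MVT_segment xt dS' cS; rewrite in_itv/= => /andP[xy _].
rewrite e normrM; apply: ler_wpM2r => //.
rewrite normrM ger0_norm ?ler0n//; apply: ler_wpM2l => //.
by apply: (Psum_bnd n.+1 (dif_bnd bM)); exact: le_trans x0 xy.
Qed.

(** The second moment of Vop n.+2 at x is 2 psi x / (n + 1); functions in the
    range of the operators are Lipschitz. *)
Lemma Vop_cvg m b M x : bseq b M -> 0 <= x ->
  Vop n.+1 (Psum m.+1 b) x @[n --> \oo] --> Psum m.+1 b x.
Proof.
move=> bM x0; have M0 := bcont_ge0 (Psum_bcont m bM).
pose A : R := m.+1%:R * (2 * M); pose g := Psum m.+1 b.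
have A0 : 0 <= A by rewrite /A !mulr_ge0.
have cg := Psum_bcont m bM; have p0 : 0 <= psi x by rewrite mulr_ge0//; lra.
have est n (e : R) : 0 < e -> `|Vop n.+2 g x - g x| <= A / 2 * (e + 2 * psi x / n.+1%:R / e).
  move=> e0.
  have h1 := sums_toB (Psum_sums_to n.+1 (v_bnd n.+1 cg) (ltNh0 x0)) (sums_toZ (g x) (P_sums_to n.+1 x0)).
  have kP := kP_sums_to n.+2 x0; have cP := lapwP_sums_to n.+2 x0; have P1 := P_sums_to n.+1 x0.
  have N1 : n.+1%:R != 0 :> R by rewrite pnatr_eq0.
  have N2 : n.+2%:R != 0 :> R by rewrite pnatr_eq0.
  pose al : R := (n.+2%:R * n.+1%:R)^-1.
  have hs := sums_toZ (A / 2) (sums_toD (sums_toZ e P1) (sums_toZ e^-1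
    (sums_toD (sums_toB (sums_toZ al cP) (sums_toZ (n.+1%:R * al + 2 * x / n.+2%:R) kP)) (sums_toZ (x ^+ 2) P1)))).
  have dom k : `|v n.+2 k g * P n.+2 k x - g x * P n.+2 k x| <= A / 2 * (e * P n.+2 k x + e^-1 *
     (al * (lapw n.+2 k * P n.+2 k x) - (n.+1%:R * al + 2 * x / n.+2%:R) * (k%:R * P n.+2 k x) + x ^+ 2 * P n.+2 k x)).
    have p := P_ge0 n.+2 k x0.
    rewrite -mulrBl normrM (ger0_norm p).
    have := @v_lip _ n g M A x e k cg A0 x0 e0 (fun t (t0 : 0 <= t) => @Psum_lipschitz m b M x t bM x0 t0).
    move=> /(ler_wpM2r p) /le_trans; apply.
    rewrite le_eqVlt; apply/orP; left; apply/eqP; rewrite /al /lapw natrM natrD.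
    rewrite -[k.+1%:R]natr1 -[n.+2%:R]natr1 in N2 *.
    move: (n.+1%:R : R) N1 N2 => N N1 N2; field; by rewrite N1 N2 lt0r_neq0.
  have [s hs' le] := sums_to_dom dom hs.
  have -> : Vop n.+2 g x - g x = s by rewrite -(sums_to_uniq h1 hs') mulr1.
  apply: (le_trans le); rewrite le_eqVlt; apply/orP; left; apply/eqP.
  rewrite /al /psi natrM -[n.+3%:R]natr1 -[n.+2%:R]natr1 in N2 *.
  by move: (n.+1%:R : R) N1 N2 => N N1 N2; field; rewrite N1 N2 lt0r_neq0.
rewrite -cvg_shiftS /=; apply/cvgrPdist_le => e e0.
pose d : R := e / (A + 1); have d0 : 0 < d by rewrite divr_gt0//; lra.
near=> n; rewrite distrC; apply: le_trans (est n d d0) _.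
have n1 : 0 < n.+1%:R :> R by rewrite ltr0n.
have nn : 2 * psi x / d ^+ 2 <= n.+1%:R.
  near: n; apply: filterS (nbhs_infty_ger (2 * psi x / d ^+ 2)) => n h.
  by apply: le_trans h _; rewrite ler_nat.
have : 2 * psi x / n.+1%:R / d <= d.
  by rewrite ler_pdivrMr// ler_pdivrMr//; move: nn; rewrite ler_pdivrMr ?exprn_gt0// expr2; lra.
move=> h; apply: (@le_trans _ _ (A / 2 * (d + d))).
  by apply: ler_wpM2l; rewrite ?lerD2l// divr_ge0.
have -> : A / 2 * (d + d) = A * d by field.
rewrite /d mulrA ler_pdivrMr; last by lra.
by rewrite mulrC ler_wpM2l// ?ltW//; lra.
Unshelve. all: by end_near. Qed.

End Operators.

(** * Voronovskaya estimate and converse inequality *)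

Section Converse.
Context {R : realType}.
Implicit Types (f g h : R -> R) (c K M t x : R) (n m k j l : nat) (a b : nat -> R).

(** Passing to the limit in |s l - s m| <= d l - d m. *)
Lemma telescope_bound (s d : nat -> R) (L : R) l :
  (forall j, (l <= j)%N -> `|s j - s j.+1| <= d j - d j.+1) -> (forall j, 0 <= d j) ->
  s @ \oo --> L -> `|s l - L| <= d l.
Proof.
move=> sd d0 sL.
have H i : `|s l - s (l + i)%N| <= d l - d (l + i)%N.
  elim: i => [|i IH]; first by rewrite addn0 !subrr normr0.
  rewrite addnS.
  have -> : s l - s (l + i).+1 = (s l - s (l + i)%N) + (s (l + i)%N - s (l + i).+1) by ring.
  apply: le_trans (ler_normD _ _) _.
  have := sd (l + i)%N (leq_addr _ _); lra.
apply/ler_addgt0Pl => e e0.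
move/cvgrPdist_le: sL => /(_ e e0)[N _ hN].
have := hN (l + N)%N (leq_addl _ _); rewrite /= distrC => h.
have -> : s l - L = (s l - s (l + N)%N) + (s (l + N)%N - L) by ring.
apply: le_trans (ler_normD _ _) _.
have := H N; have := d0 (l + N)%N; lra.
Qed.

Lemma Vop_step n m b M x : bseq b M -> 0 <= x ->
  Vop n.+1 (Psum m.+1 b) x - Vop n.+2 (Psum m.+1 b) x = (n.+1 * n.+2)%:R^-1 * Vop n.+1 (DtPsum m.+1 b) x.
Proof.
move=> bM x0; rewrite (Vop_succ n (Psum_bcont m bM) x0) (DtPsum_v n m bM x0); ring.
Qed.

Lemma Vop_ext n f g : (forall x, 0 <= x -> f x = g x) -> Vop n f = Vop n g.
Proof.
move=> fg; rewrite /Vop; congr (Psum n _); apply/funext => k.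
by apply: v_ext => x x0; apply: fg; exact: ltW.
Qed.

Lemma Vop_bnd n f M x : bcont f M -> 0 <= x -> `|Vop n.+1 f x| <= M.
Proof. by move=> cf x0; apply: Psum_bnd x0; exact: v_bnd. Qed.

(** The increments of Vop are at most K (1/n - 1/(n+1)) by Vop_step. *)
Lemma Vop_rate n m b M K x : bseq b M -> bcont (DtPsum m.+1 b) K -> 0 <= x ->
  `|Vop n.+1 (Psum m.+1 b) x - Psum m.+1 b x| <= K / n.+1%:R.
Proof.
move=> bM cK x0; have K0 := bcont_ge0 cK.
apply: (@telescope_bound (fun n => Vop n.+1 (Psum m.+1 b) x) (fun n => K / n.+1%:R)).
- move=> j _; rewrite (Vop_step _ _ bM x0) normrM.
  rewrite (ger0_norm (_ : 0 <= (j.+1 * j.+2)%:R^-1)) ?invr_ge0 ?ler0n//.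
  have -> : K / j.+1%:R - K / j.+2%:R = (j.+1 * j.+2)%:R^-1 * K.
    rewrite natrM -[j.+2%:R]natr1; have : 0 < j.+1%:R :> R by rewrite ltr0n.
    by move: (j.+1%:R : R) => N N0; field; lra.
  by apply: ler_wpM2l; rewrite ?invr_ge0 ?ler0n//; exact: Vop_bnd.
- by move=> j; rewrite divr_ge0.
- exact: (Vop_cvg bM x0).
Qed.

Lemma Vmod_Psum n m b M x : bseq b M -> 0 <= x ->
  Vmod n.+1 (Psum m.+1 b) x = Vop n.+1 (Psum m.+1 b) x - n.+1%:R^-1 * Vop n.+1 (DtPsum m.+1 b) x.
Proof. by move=> bM x0; rewrite (Vmod_Vop n (Psum_bcont m bM) x0) (DtPsum_v n m bM x0). Qed.

(** The terms of first order in Dt cancel, since 1/n - 1/(n+1) = 1/(n(n+1)); this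
    is what the correction term of Vt is for. *)
Lemma Vmod_step n m b a M K x : bseq b M -> bseq a K -> 0 <= x ->
  (forall y, 0 <= y -> DtPsum m.+1 b y = Psum m.+1 a y) ->
  Vmod n.+1 (Psum m.+1 b) x - Vmod n.+2 (Psum m.+1 b) x =
  - (n.+1%:R * n.+2%:R ^+ 2)^-1 * Vop n.+1 (DtPsum m.+1 a) x.
Proof.
move=> bM aK x0 ba; rewrite !(Vmod_Psum _ _ bM x0).
have e := Vop_step n m bM x0; have e2 := Vop_step n m aK x0.
rewrite !(Vop_ext _ ba) in e *.
have N0 : 0 < n.+1%:R :> R by rewrite ltr0n.
move: e e2; rewrite natrM -[n.+2%:R]natr1.
move: (Vop n.+1 (Psum m.+1 b) x) (Vop n.+2 (Psum m.+1 b) x) (Vop n.+1 (Psum m.+1 a) x) (Vop n.+2 (Psum m.+1 a) x)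
  (Vop n.+1 (DtPsum m.+1 a) x) (n.+1%:R : R) N0 => g1 g2 h1 h2 u N N0 e e2.
have -> : g1 = g2 + (N * (N + 1))^-1 * h1 by rewrite -e subrKC.
have -> : h1 = h2 + (N * (N + 1))^-1 * u by rewrite -e2 subrKC.
by field; lra.
Qed.

Lemma Vmod_cvg m b M x : bseq b M -> 0 <= x ->
  Vmod n.+1 (Psum m.+1 b) x @[n --> \oo] --> Psum m.+1 b x.
Proof.
move=> bM x0; have cD := DtPsum_bcont m bM.
have -> : (fun n => Vmod n.+1 (Psum m.+1 b) x) =
    fun n => Vop n.+1 (Psum m.+1 b) x - n.+1%:R^-1 * Vop n.+1 (DtPsum m.+1 b) x.
  by apply/funext => n; rewrite (Vmod_Psum _ _ bM x0).
rewrite -[X in _ --> X]subr0; apply: cvgB; first exact: (Vop_cvg bM x0).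
set K := 16 * _ * M in cD.
apply/cvgrPdist_le => e e0; near=> n; rewrite sub0r normrN normrM.
have n0 : 0 < n.+1%:R :> R by rewrite ltr0n.
rewrite normfV (gtr0_norm n0) ler_pdivrMl//.
apply: le_trans (Vop_bnd n cD x0) _; rewrite -ler_pdivrMr//.
near: n; apply: filterS (nbhs_infty_ger (K / e)) => n h.
by apply: le_trans h _; rewrite ler_nat.
Unshelve. all: by end_near. Qed.

(** Summing Vmod_step exactly would give the coefficient sum of 1/(j(j+1)^2)
    instead of 1/(2 n^2). Replacing it by the latter costs an error of relative
    order 1/n, the |Dt^2 g| / 2 on the right. All the errors are at most
    constants times 1/(j^2 (j+1)^2), less than an increment of 1/j^3. *)
Lemma voronovskaya n m b a d M K H J x : bseq b M -> bseq a K -> bseq d H -> 0 <= x ->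
  (forall y, 0 <= y -> DtPsum m.+1 b y = Psum m.+1 a y) ->
  (forall y, 0 <= y -> DtPsum m.+1 a y = Psum m.+1 d y) ->
  bcont (DtPsum m.+1 d) J ->
  `|Vmod n.+1 (Psum m.+1 b) x - Psum m.+1 b x + DtPsum m.+1 a x / (2 * n.+1%:R ^+ 2)| <=
  (J + `|DtPsum m.+1 a x| / 2) / n.+1%:R ^+ 3.
Proof.
move=> bM aK dH x0 ba ad cJ; have J0 := bcont_ge0 cJ.
set u := DtPsum m.+1 a x; set C := J + `|u| / 2.
have C0 : 0 <= C by rewrite addr_ge0// divr_ge0.
pose s j := Vmod j.+1 (Psum m.+1 b) x + u / (2 * j.+1%:R ^+ 2).
have -> : Vmod n.+1 (Psum m.+1 b) x - Psum m.+1 b x + u / (2 * n.+1%:R ^+ 2) = s n - Psum m.+1 b x.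
  by rewrite /s; ring.
apply: (@telescope_bound s (fun j => C / j.+1%:R ^+ 3)).
- move=> j _.
  have e := Vmod_step j bM aK x0 ba.
  have r := Vop_rate j dH cJ x0.
  rewrite -(Vop_ext _ ad) -ad// -/u in r.
  rewrite /s; move: e r; set v' := Vop _ _ _.
  have N0 : 0 < j.+1%:R :> R by rewrite ltr0n.
  rewrite -[j.+2%:R]natr1; move: (Vmod j.+1 _ _) (Vmod j.+2 _ _) => t1 t2.
  move: (j.+1%:R : R) N0 => N N0 e r.
  have -> : t1 + u / (2 * N ^+ 2) - (t2 + u / (2 * (N + 1) ^+ 2)) =
     (N * (N + 1) ^+ 2)^-1 * (- (v' - u) + u / (2 * N)).
    have -> : t1 = t2 - (N * (N + 1) ^+ 2)^-1 * v' by rewrite -mulNr -e subrKC.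
    by field; lra.
  have w0 : 0 < N * (N + 1) ^+ 2 by rewrite mulr_gt0// exprn_gt0//; lra.
  rewrite normrM normfV (gtr0_norm w0) ler_pdivrMl//.
  have h : `|- (v' - u) + u / (2 * N)| <= C / N.
    apply: le_trans (ler_normD _ _) _; rewrite normrN normrM normfV.
    rewrite [`|2 * N|]gtr0_norm; last by lra.
    have -> : C / N = J / N + `|u| / (2 * N) by rewrite /C; field; lra.
    by rewrite lerD2r.
  apply: (le_trans h).
  have -> : N * (N + 1) ^+ 2 * (C / N ^+ 3 - C / (N + 1) ^+ 3) =
     C / N * ((3 * N ^+ 2 + 3 * N + 1) / (N * (N + 1))) by field; lra.
  rewrite -[leLHS]mulr1; apply: ler_wpM2l; first by rewrite divr_ge0// ltW.
  rewrite ler_pdivlMr; first by rewrite expr2; nra.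
  by rewrite mulr_gt0//; lra.
- by move=> j; rewrite divr_ge0//.
- rewrite -[X in _ --> X]addr0; apply: cvgD; first exact: (Vmod_cvg bM x0).
  apply/cvgrPdist_le => e e0; near=> j; rewrite sub0r normrN.
  have N0 : 0 < j.+1%:R :> R by rewrite ltr0n.
  have N1 : 1 <= j.+1%:R :> R by rewrite ler1n.
  have hN : `|u| / e <= j.+1%:R.
    near: j; apply: filterS (nbhs_infty_ger (`|u| / e)) => j h.
    by apply: le_trans h _; rewrite ler_nat.
  move: hN; rewrite ler_pdivrMr// => hN.
  rewrite normrM normfV (ger0_norm (_ : 0 <= 2 * _)) ?mulr_ge0 ?exprn_ge0//.
  have Q0 : 0 < 2 * j.+1%:R ^+ 2 :> R by rewrite mulr_gt0// exprn_gt0.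
  rewrite ler_pdivrMr//; apply: (le_trans hN).
  by rewrite mulrC; apply: ler_wpM2l; [exact: ltW|rewrite expr2; nra].
Unshelve. all: by end_near. Qed.

(** The hypothesis is applied to the supremum of |u|. *)
Lemma absorb (u : R -> R) B W : (forall x, 0 <= x -> `|u x| <= B) ->
  (forall U, (forall x, 0 <= x -> `|u x| <= U) -> forall x, 0 <= x -> `|u x| <= U / 2 + W) ->
  forall x, 0 <= x -> `|u x| <= 2 * W.
Proof.
move=> uB h x x0; pose A := [set `|u y| | y in [set y | 0 <= y]].
have ub : has_ubound A by exists B => _ [y y0 <-]; exact: uB.
have An : A !=set0 by exists `|u x|; exists x.
have le y : 0 <= y -> `|u y| <= sup A by move=> y0; apply: ub_le_sup => //; exists y.
have := h _ le => h2.
have : sup A <= sup A / 2 + W by apply: ge_sup => // _ [y y0 <-]; exact: h2.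
have := le x x0; lra.
Qed.

(** Here and below 17 bounds the norm of Vmod, and 307 = 1 + 17 + 17^2. *)
Lemma iterate_error (y0 y1 y2 y3 e : R) : `|y0 - y1| <= e -> `|y1 - y2| <= 17 * e ->
  `|y2 - y3| <= 17 * (17 * e) -> `|y0 - y3| <= 307 * e.
Proof. rewrite !ler_norml; lra. Qed.

(** For y0 = f x, y1 = Vmod f x, y3 = g x and y2 = Vmod g x; the factor is
    18 = 1 + 17 because f - g enters directly and through Vmod. *)
Lemma level_error (y0 y1 y2 y3 e e' : R) : `|y1 - y2| <= 17 * (307 * e) -> `|y1 - y0| <= e' ->
  `|y0 - y3| <= 307 * e -> `|y2 - y3| <= 18 * 307 * e + e'.
Proof. rewrite !ler_norml; lra. Qed.

Lemma norm_le_add (y z U c : R) : `|y - z| <= c -> `|z| <= U -> `|y| <= U + c.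
Proof. rewrite !ler_norml; lra. Qed.

(** Here u is Dt^2 g at a point, z the error of Vmod at level Q, U a bound of |u|
    and K N (U + X) the bound of Dt^3 g given by Bernstein. The condition
    8 K N <= Q makes the contribution of U to the right-hand side at most U / 2. *)
Lemma absorb_step (K N Q E X u z U : R) : 2 <= Q -> 8 * K * N <= Q ->
  0 <= U -> 0 <= X -> `|z| <= E ->
  `|z + u / (2 * Q ^+ 2)| <= (K * N * (U + X) + `|u| / 2) / Q ^+ 3 ->
  `|u| <= U / 2 + (4 * Q ^+ 2 * E + X / 2).
Proof.
move=> Q2 NQ U0 X0 hz h.
have Q0 : 0 < Q by lra.
have QQ : 0 < 2 * Q ^+ 2 by rewrite mulr_gt0// exprn_gt0.
have h1 : `|u| / (2 * Q ^+ 2) <= E + (K * N * (U + X) + `|u| / 2) / Q ^+ 3.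
  have -> : `|u| / (2 * Q ^+ 2) = `|u / (2 * Q ^+ 2)| by rewrite normrM normfV (gtr0_norm QQ).
  move: h hz; move: (u / _) (_ / Q ^+ 3) => p q; rewrite !ler_norml; lra.
have h2 : `|u| <= 2 * Q ^+ 2 * E + (2 * K * N * (U + X) / Q + `|u| / Q).
  move: h1; rewrite ler_pdivrMr// => /le_trans; apply.
  by rewrite le_eqVlt; apply/orP; left; apply/eqP; field; rewrite lt0r_neq0.
have h3 : 2 * K * N * (U + X) / Q <= (U + X) / 4.
  rewrite ler_pdivrMr//.
  have -> : 2 * K * N * (U + X) = (U + X) / 4 * (8 * K * N) by field.
  by apply: ler_wpM2l => //; rewrite divr_ge0// addr_ge0.
have h4 : `|u| / Q <= `|u| / 2.
  by apply: ler_wpM2l => //; rewrite lef_pV2 ?posrE//; lra.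
move: h2 h3 h4; move: (2 * K * N * (U + X) / Q) (`|u| / Q) => p q; lra.
Qed.

Lemma absorb_constants (N Q e1 e2 : R) : 0 <= N -> N <= Q -> 0 <= e1 -> 0 <= e2 ->
  4 * Q ^+ 2 * (18 * 307 * e1 + e2) + 272 * 272 * N ^+ 2 * e1 / 2 <=
  (4 * (18 * 307) + 136 * 272) * Q ^+ 2 * (e1 + e2).
Proof.
move=> N0 NQ e10 e20.
have NN : N ^+ 2 <= Q ^+ 2 by rewrite ler_pXn2r// nnegrE (le_trans N0).
have h5 := ler_wpM2r e10 NN.
have Q0 : 0 <= Q ^+ 2 by exact: sqr_ge0.
have h6 := mulr_ge0 Q0 e10; have h7 := mulr_ge0 Q0 e20.
have -> : 4 * Q ^+ 2 * (18 * 307 * e1 + e2) =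
  4 * (18 * 307) * (Q ^+ 2 * e1) + 4 * (Q ^+ 2 * e2) by ring.
have -> : 272 * 272 * N ^+ 2 * e1 / 2 = 136 * 272 * (N ^+ 2 * e1) by field.
have -> : (4 * (18 * 307) + 136 * 272) * Q ^+ 2 * (e1 + e2) =
  (4 * (18 * 307) + 136 * 272) * (Q ^+ 2 * e1 + Q ^+ 2 * e2) by ring.
move: h5 h6 h7; move: (N ^+ 2 * e1) (Q ^+ 2 * e1) (Q ^+ 2 * e2) => p q r; lra.
Qed.

(** The function Psum n.+1 b is the third iterate g = Vt^3 f, and [a], [d] are
    the coefficients of Dt g and Dt^2 g. Three iterations are needed: one for
    each application of Dt. With N = n + 1 and 272 = 16 * 17, the last one gives
    Dt^3 g the bound 272 N times that of Dt^2 (Vt^2 f). Replacing Vt^2 f by g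
    costs (272 N)^2 e1, and then Dt^2 g can be absorbed. *)
Lemma converse_bound n l f B (e1 e2 : R) : bcont f B ->
  (forall x, 0 <= x -> `|Vmod n.+1 f x - f x| <= e1) ->
  (forall x, 0 <= x -> `|Vmod l.+1 f x - f x| <= e2) ->
  (8 * 272 * n.+1 <= l.+1)%N ->
  exists b a d M, [/\ [/\ bseq b M, bseq a M & bseq d M],
    forall x, 0 <= x -> DtPsum n.+1 b x = Psum n.+1 a x,
    forall x, 0 <= x -> DtPsum n.+1 a x = Psum n.+1 d x,
    forall x, 0 <= x -> `|f x - Psum n.+1 b x| <= 307 * e1 &
    forall x, 0 <= x -> `|DtPsum n.+1 a x| <= (8 * (18 * 307) + 272 * 272) * l.+1%:R ^+ 2 * (e1 + e2)].
Proof.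
move=> cf h1 h2 nl.
have c1 := Vmod_bcont n cf; have c2 := Vmod_bcont n c1.
pose b1 := vmod n.+1 f; pose b2 := vmod n.+1 (Vmod n.+1 f); pose b3 := vmod n.+1 (Vmod n.+1 (Vmod n.+1 f)).
have B1 : bseq b1 (17 * B) := vmod_bnd n cf.
have B2 : bseq b2 (17 * (17 * B)) := vmod_bnd n c1.
have B3 : bseq b3 (17 * (17 * (17 * B))) := vmod_bnd n c2.
have cD1 := DtPsum_bcont n B1; have cD2 := DtPsum_bcont n B2.
pose a2 := vmod n.+1 (DtPsum n.+1 b1); pose a3 := vmod n.+1 (DtPsum n.+1 b2).
have A2 : bseq a2 _ := vmod_bnd n cD1.
have A3 : bseq a3 _ := vmod_bnd n cD2.
have cE2 := DtPsum_bcont n A2.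
pose d3 := vmod n.+1 (DtPsum n.+1 a2).
have D3 : bseq d3 _ := vmod_bnd n cE2.
have E2 x : 0 <= x -> DtPsum n.+1 b2 x = Psum n.+1 a2 x by exact: (DtPsum_vmod n n B1).
have E3 x : 0 <= x -> DtPsum n.+1 b3 x = Psum n.+1 a3 x by exact: (DtPsum_vmod n n B2).
have F3 x : 0 <= x -> DtPsum n.+1 a3 x = Psum n.+1 d3 x.
  by rewrite /a3 (vmod_ext _ E2); exact: (DtPsum_vmod n n A2).
(* Every estimate in terms of e1 below comes from applying the operators to
   the defect f - Vmod n.+1 f, by linearity of vmod. *)
have e10 : 0 <= e1 := le_trans (normr_ge0 _) (h1 0 (lexx _)).
have e20 : 0 <= e2 := le_trans (normr_ge0 _) (h2 0 (lexx _)).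
have cF : bcont (fun x => f x - Vmod n.+1 f x) e1.
  by split; [exact: (bcontB cf c1).1 | move=> x x0; rewrite distrC; exact: h1].
have tF : vmod n.+1 (fun x => f x - Vmod n.+1 f x) = fun k => b1 k - b2 k := vmodB n cf c1.
have bF := vmod_bnd n cF; rewrite tF in bF.
have cG : bcont (fun x => Vmod n.+1 f x - Vmod n.+1 (Vmod n.+1 f) x) (17 * e1).
  split; first exact: (bcontB c1 c2).1.
  by move=> x x0; rewrite -(PsumB n B1 B2 x0); exact: Psum_bnd bF x0.
have tG : vmod n.+1 (fun x => Vmod n.+1 f x - Vmod n.+1 (Vmod n.+1 f) x) = fun k => b2 k - b3 k := vmodB n c1 c2.
have bG := vmod_bnd n cG; rewrite tG in bG.
have fg x : 0 <= x -> `|f x - Psum n.+1 b3 x| <= 307 * e1.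
  move=> x0; have q1 := cF.2 x x0; have q2 : `|Vmod n.+1 f x - Psum n.+1 b2 x| <= 17 * e1 := cG.2 x x0; have q3 := Psum_bnd n bG x0.
  rewrite (PsumB n B2 B3 x0) in q3.
  exact: iterate_error q1 q2 q3.
have cDF : bcont (fun x => DtPsum n.+1 b1 x - DtPsum n.+1 b2 x) (16 * n.+1%:R * (17 * e1)).
  split; first exact: (bcontB cD1 cD2).1.
  by move=> x x0; rewrite -(DtPsumB n.+1 B1 B2 x0); exact: bernstein_sum bF x0.
have bDF := vmod_bnd n cDF.
have tDF : vmod n.+1 (fun x => DtPsum n.+1 b1 x - DtPsum n.+1 b2 x) = fun k => a2 k - a3 k := vmodB n cD1 cD2.
rewrite tDF in bDF.
pose N : R := n.+1%:R; pose Q : R := l.+1%:R.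
have N0 : 0 < N by rewrite ltr0n.
have NQ : 8 * 272 * N <= Q by rewrite /N /Q -!natrM ler_nat.
have dE x : 0 <= x -> `|DtPsum n.+1 a2 x - DtPsum n.+1 a3 x| <= 272 * 272 * N ^+ 2 * e1.
  move=> x0; rewrite -(DtPsumB n.+1 A2 A3 x0).
  have := bernstein_sum n bDF x0; rewrite -/N.
  have -> : 16 * N * (17 * (16 * N * (17 * e1))) = 272 * 272 * N ^+ 2 * e1 by ring.
  by [].
have gl x : 0 <= x -> `|Vmod l.+1 (Psum n.+1 b3) x - Psum n.+1 b3 x| <= 18 * 307 * e1 + e2.
  move=> x0.
  have cfg : bcont (fun x => f x - Psum n.+1 b3 x) (307 * e1).
    by split => //; exact: (bcontB cf (Psum_bcont n B3)).1.
  have t1 := Psum_bnd l (vmod_bnd l cfg) x0.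
  rewrite (vmodB l cf (Psum_bcont n B3)) (PsumB l (vmod_bnd l cf) (vmod_bnd l (Psum_bcont n B3)) x0) in t1.
  have t2 : `|Psum l.+1 (vmod l.+1 f) x - f x| <= e2 := h2 x x0; have t3 := fg x x0.
  exact: level_error t1 t2 t3.
exists b3, a3, d3.
have [M [M1 M2 M3]] : exists M, [/\ bseq b3 M, bseq a3 M & bseq d3 M].
  set x1 := (X in bseq b3 X) in B3; set x2 := (X in bseq a3 X) in A3; set x3 := (X in bseq d3 X) in D3.
  exists (Num.max x1 (Num.max x2 x3)); split=> k.
  - by rewrite !le_max B3.
  - by rewrite !le_max A3 orbT.
  - by rewrite !le_max D3 !orbT.
exists M; split => //.
pose W : R := (4 * (18 * 307) + 136 * 272) * Q ^+ 2 * (e1 + e2).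
have -> : (8 * (18 * 307) + 272 * 272) * l.+1%:R ^+ 2 * (e1 + e2) = 2 * W by rewrite /W /Q; ring.
have hB x : 0 <= x -> `|DtPsum n.+1 a3 x| <= M by move=> x0; rewrite F3//; exact: Psum_bnd.
apply: (absorb hB) => U hU x x0.
have cE : bcont (DtPsum n.+1 a2) (U + 272 * 272 * N ^+ 2 * e1).
  split; first exact: cE2.1.
  by move=> y y0; exact: norm_le_add (dE y y0) (hU y y0).
have cJ := DtPsum_bcont n (vmod_bnd n cE); rewrite -/d3 -/N in cJ.
have U0 : 0 <= U by exact: le_trans (normr_ge0 _) (hU 0 (lexx _)).
have N1 : 1 <= N by rewrite /N ler1n.
have Q2 : 2 <= Q by move: NQ N1; move: (N) (Q) => N' Q'; lra.
have X0 : 0 <= 272 * 272 * N ^+ 2 * e1.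
  exact: mulr_ge0 (mulr_ge0 (mulr_ge0 (ler0n _ 272) (ler0n _ 272)) (sqr_ge0 _)) e10.
have v1 := voronovskaya l M1 M2 M3 x0 E3 F3 cJ.
have eJ : 16 * N * (17 * (U + 272 * 272 * N ^+ 2 * e1)) = 272 * N * (U + 272 * 272 * N ^+ 2 * e1) by ring.
rewrite eJ in v1.
have h := absorb_step Q2 NQ U0 X0 (gl x x0) v1.
apply: (le_trans h); rewrite lerD2l.
apply: (absorb_constants (ltW N0) _ e10 e20).
by move: NQ N0; move: (N) (Q) => N' Q'; lra.
Qed.

End Converse.

(** * Norms, function spaces and the K-functional *)

Section Bridge.
Context {R : realType}.
Implicit Types (f g h : R -> R) (c K M t x : R) (n m k j l : nat) (a b : nat -> R).
Local Notation mu := (@lebesgue_measure R).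

Lemma Dt_is_derive (f g1 : R -> R) (x y : R) : (\forall z \near x, is_derive (z : R) 1 f (g1 z)) ->
  is_derive x 1 g1 y -> Dt f x = psi x * y.
Proof.
move=> df dg; rewrite /Dt; congr (_ * _).
have e : \near x, g1 x = (f^`())%classic x.
  by near=> z; rewrite derive1E; have [_ ->] : is_derive z 1 f (g1 z) by near: z.
by rewrite derive1E; have [_] := near_eq_is_derive e dg.
Unshelve. all: by end_near. Qed.

Lemma Dt_Psum n a M x : bseq a M -> - 2^-1 < x -> Dt (Psum n.+1 a) x = DtPsum n.+1 a x.
Proof.
move=> aM hx; have d2 := is_derive_Psum n.+1 (dif_bnd aM) hx.
rewrite (@Dt_is_derive _ (fun y => n.+1%:R * Psum n.+2 (dif a) y) x
  (n.+1%:R * (n.+2%:R * Psum n.+3 (dif (dif a)) x))).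
- by rewrite /DtPsum natrM; ring.
- by near=> z; apply: (is_derive_Psum n aM); near: z; exact: lt_nbhsr.
Unshelve. all: by end_near. Qed.

Lemma near_eq_gt0 f g (x : R) : (forall y, 0 <= y -> f y = g y) -> 0 < x -> \near x, f x = g x.
Proof.
move=> fg x0; near=> z; apply: fg; apply: ltW; near: z; exact: lt_nbhsr.
Unshelve. all: by end_near. Qed.

Lemma derive1_ext f g (x : R) : (forall y, 0 <= y -> f y = g y) -> 0 < x ->
  (f^`())%classic x = (g^`())%classic x.
Proof. by move=> fg x0; rewrite !derive1E; apply: near_eq_derive; exact: near_eq_gt0. Qed.

Lemma Dt_ext f g x : (forall y, 0 <= y -> f y = g y) -> 0 <= x -> Dt f x = Dt g x.
Proof.
move=> fg x_ge0; have psi0 : psi 0 = 0 :> R by rewrite /psi mul0r.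
move: x_ge0; rewrite le_eqVlt => /orP[/eqP <-|x0].
  by rewrite /Dt psi0 [LHS]mul0r [RHS]mul0r.
apply: (congr1 (fun z => psi x * z)).
rewrite [LHS]derive1E.
rewrite [RHS]derive1E.
apply: near_eq_derive.
near=> z; apply: (derive1_ext fg); near: z; exact: lt_nbhsr.
Unshelve. all: by end_near. Qed.

Lemma delta_bnd k : bseq (fun j => (j == k)%:R : R) 1.
Proof. by move=> j; case: (j == k); rewrite ?normr1 ?normr0. Qed.

Lemma Pt_E n k x : 0 <= x -> Pt n.+1 k x = P n.+1 k x - n.+1%:R^-1 * DtP n.+1 k x.
Proof.
move=> x0; rewrite /Pt; congr (_ - _ * _).
rewrite (@Dt_ext _ (Psum n.+1 (fun j => (j == k)%:R)) x _ x0); last first.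
  by move=> y y0; rewrite P_Psum//; exact: ltNh0.
rewrite (Dt_Psum n (delta_bnd k) (ltNh0 x0)).
exact: sums_to_uniq (DtPsum_parts n.+1 (delta_bnd k) x0) (sums_to_delta _ k).
Qed.

(** DtPsum_parts, read from right to left. *)
Lemma Vt_Vmod n f M x : bcont f M -> 0 <= x -> Vt n.+1 f x = Vmod n.+1 f x.
Proof.
move=> cf x0; rewrite (Vmod_Vop n cf x0); have b := v_bnd n cf.
apply: (proj2 (_ : sums_to _ _)).
apply: (sums_to_eq (sums_toB (Psum_sums_to n b (ltNh0 x0)) (sums_toZ n.+1%:R^-1 (DtPsum_parts n.+1 b x0)))) => k.
by rewrite Pt_E//; ring.
Qed.

Lemma unorm_ext f g : (forall x, 0 <= x -> f x = g x) -> unorm f = unorm g.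
Proof.
move=> fg; rewrite /unorm; congr Lnorm; apply/funext => x /=; congr EFin.
by rewrite !patchE; case: ifPn => // /set_mem /=; rewrite in_itv/= andbT => /fg.
Qed.

Lemma unorm_ess (h : R -> R) (M : R) :
  (unorm h <= M%:E)%E <-> {ae mu, forall x, `|(h \_ `[0, +oo[) x| <= M}.
Proof.
rewrite /unorm unlock /Lnorm.
have -> : (0 < mu [set: R])%E.
  by rewrite -set_itvNyy lebesgue_measure_itv /= addye// ltry.
have mono := @filterS _ _ (ae_filter_ringOfSetsType mu).
split=> [/ess_supP|] H.
  by apply: mono H => x /=; rewrite lee_fin.
by apply/ess_supP; apply: mono H => x /=; rewrite lee_fin.
Qed.

Lemma unorm_le h M : (forall x, 0 <= x -> `|h x| <= M) -> (unorm h <= M%:E)%E.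
Proof.
move=> hM; apply/unorm_ess; apply: (@nearW _ _ _ (ae_filter_ringOfSetsType mu)) => x; rewrite patchE; case: ifPn => xi.
  by apply: hM; move/set_mem: xi; rewrite /= in_itv/= andbT.
by rewrite normr0; apply: le_trans (hM 0 (lexx _)).
Qed.

(** A continuous function that exceeds its essential supremum at one point
    exceeds it on an interval. *)
Lemma unorm_ge h (M : R) x : {within `[0, +oo[, continuous h} -> (unorm h <= M%:E)%E ->
  0 <= x -> `|h x| <= M.
Proof.
move=> ch /unorm_ess [N [mN N0 hN]] x0; rewrite leNgt; apply/negP => hx.
have [d d0 hd] : exists2 d : R, 0 < d & forall y, x < y -> y < x + d -> M < `|h y|.
  have cx : h y @[y --> x^'+] --> h x.
    move: ch => /continuous_within_itvcyP[ch c0].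
    move: x0 hx; rewrite le_eqVlt => /orP[/eqP <- //|x0 _].
    apply: cvg_at_right_filter; apply: ch; by rewrite in_itv/= x0.
  have cx' : `|h y| @[y --> x^'+] --> `|h x| by exact: cvg_norm.
  have : \forall y \near x^'+, M < `|h y| by exact: (cvgr_gt _ cx').
  move=> [d /= d0 hd]; exists d => // y xy yd; apply: hd => //=.
  by rewrite distrC gtr0_norm ?subr_gt0//; lra.
have : (mu `]x, (x + d)%R[ <= mu N)%E.
  apply: le_measure; rewrite ?inE//.
  move=> y /=; rewrite in_itv/= => /andP[xy yd]; apply: hN => /=.
  rewrite patchE mem_set/=; last by rewrite in_itv/= andbT; apply/ltW; exact: le_lt_trans xy.
  by move=> H; have := hd y xy yd; rewrite ltNge H.
rewrite N0 lebesgue_measure_itv/= lte_fin ltrDl d0 -EFinD lee_fin; lra.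
Qed.

Lemma Linfty_bcont h g M : bcont g M -> (forall x, 0 <= x -> h x = g x) -> Linfty h.
Proof.
move=> cg hg; rewrite /Linfty.
have -> : h \_ `[0, +oo[ = g \_ `[0, +oo[.
  by apply/funext => x; rewrite !patchE; case: ifPn => // /set_mem /=; rewrite in_itv/= andbT => /hg.
rewrite inE; apply/andP; split.
  rewrite inE /=; apply/(measurable_restrictT _ _).1 => //.
  by apply: subspace_continuous_measurable_fun => //; exact: cg.1.
by rewrite inE /= /finite_norm; apply: le_lt_trans (unorm_le cg.2) _; exact: ltry.
Qed.

Lemma lipschitz_ACloc f A : (forall x t, 0 < x -> 0 < t -> `|f t - f x| <= A * `|t - x|) ->
  ACloc f.
Proof.
move=> fA a b a0 ab e e0.
pose B := `|A| + 1; have B0 : 0 < B by rewrite ltr_wpDl.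
exists (e / B); first by rewrite divr_gt0.
move=> m I hI _ hs.
apply: (@le_lt_trans _ _ (\sum_(i < m) B * ((I i).2 - (I i).1))).
  apply: ler_sum => i _; have [h1 [h2 h3]] := hI i.
  apply: le_trans (fA _ _ _ _) _; [exact: lt_le_trans h1| |].
    by apply: lt_le_trans h2; exact: lt_le_trans h1.
  rewrite ger0_norm ?subr_ge0//; apply: ler_wpM2r; first by rewrite subr_ge0.
  by have := ler_norm A; rewrite /B; lra.
by rewrite -mulr_sumr mulrC -ltr_pdivlMr.
Qed.

(** A Baskakov series and its derivative are Lipschitz on [0, oo), hence locally
    absolutely continuous. The form with [h] covers Dt g, which is such a
    series only on [0, oo). *)
Lemma W2_Psum n a M h : bseq a M -> (forall x, 0 <= x -> h x = Psum n.+1 a x) -> W2 h.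
Proof.
move=> aM hS; have d1 := dif_bnd aM.
have dh (x : R) : 0 < x -> is_derive x 1 h (n.+1%:R * Psum n.+2 (dif a) x).
  move=> x0; apply: near_eq_is_derive (is_derive_Psum n aM (ltNh0 (ltW x0))).
  by apply: near_eq_gt0 => // y y0; rewrite hS.
split.
- by move=> x /dh [].
- apply: (@lipschitz_ACloc _ (n.+1%:R * (2 * M))) => x t x0 t0.
  rewrite (hS x (ltW x0)) (hS t (ltW t0)).
  by apply: (Psum_lipschitz n aM); exact: ltW.
- apply: (@lipschitz_ACloc _ (n.+1%:R * (n.+2%:R * (2 * (2 * M))))) => x t x0 t0.
  rewrite !derive1E; have [_ ->] := dh x x0; have [_ ->] := dh t t0.
  rewrite -mulrBr normrM ger0_norm ?ler0n// -[leRHS]mulrA; apply: ler_wpM2l => //.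
  by apply: (Psum_lipschitz n.+1 d1); exact: ltW.
- apply: (Linfty_bcont (DtPsum_bcont n aM)) => x x0.
  by rewrite (Dt_ext hS x0) (Dt_Psum n aM (ltNh0 x0)).
Qed.

Lemma W20_Psum n a M : bseq a M -> W20 (Psum n.+1 a).
Proof.
move=> aM; split; first exact: (W2_Psum aM).
have c : {for 0, continuous (DtPsum n.+1 a)}.
  apply: continuousM; last exact: (cts_Psum (dif_bnd (dif_bnd aM)) (lexx _)).
  by apply: continuousM; [exact: cst_continuous|exact: cts_psi].
have DS0 : DtPsum n.+1 a 0 = 0 by rewrite /DtPsum /psi mul0r mulr0 mul0r.
have c0 : DtPsum n.+1 a z @[z --> 0^'+] --> (0 : R).
  by have := cvg_at_right_filter c; rewrite DS0.
apply: cvg_trans c0; apply: near_eq_cvg; near=> z.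
by rewrite (Dt_Psum n aM)//; apply: ltNh0; apply: ltW; near: z; exact: nbhs_right_gt.
Unshelve. all: by end_near. Qed.

(** The competitor in the K-functional is the third iterate of converse_bound.
    By continuity the essential suprema on the right-hand side bound the
    defects at every point. *)
Lemma Kfun_le_defect n l f (c K : R) : 0 <= K -> 307 + K <= c ->
  8 * (18 * 307) + 272 * 272 = K -> bounded_continuous f -> (8 * 272 * n.+1 <= l.+1)%N ->
  (Kfun f (n.+1%:R ^- 2) <= (c * (l.+1%:R ^+ 2 / n.+1%:R ^+ 2))%:E *
     (unorm (Vt n.+1 f \- f)%R + unorm (Vt l.+1 f \- f)%R))%E.
Proof.
move=> K0 cK KE [cf [B fB]] nl; have cfB : bcont f B by split.
have cT j : bcont (fun x => Vmod j.+1 f x - f x) (17 * B + B) by exact: bcontB (Vmod_bcont j cfB) cfB.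
have uT j : unorm (Vt j.+1 f \- f)%R = unorm (fun x => Vmod j.+1 f x - f x).
  by apply: unorm_ext => x x0 /=; rewrite (Vt_Vmod j cfB x0).
have fin j : exists e : R, (e%:E <= unorm (Vt j.+1 f \- f)%R)%E /\
    forall x, 0 <= x -> `|Vmod j.+1 f x - f x| <= e.
  have le := unorm_le (cT j).2; have ge : (0 <= unorm (fun x => Vmod j.+1 f x - f x)%R)%E by exact: Lnorm_ge0.
  rewrite uT; move: le ge (@unorm_ge (fun x => Vmod j.+1 f x - f x)); case: (unorm _) => [e _ _ H||] //.
  by exists e; split=> // x x0; apply: (H _ _ (cT j).1).
have [e1 [le1 h1]] := fin n; have [e2 [le2 h2]] := fin l.
have [b [a [d [M [[bM aM dM] ba ad fg u_le]]]]] := converse_bound cfB h1 h2 nl.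
have e10 : 0 <= e1 := le_trans (normr_ge0 _) (h1 0 (lexx _)).
have e20 : 0 <= e2 := le_trans (normr_ge0 _) (h2 0 (lexx _)).
have g1 x : 0 <= x -> Dt (Psum n.+1 b) x = Psum n.+1 a x.
  by move=> x0; rewrite (Dt_Psum n bM (ltNh0 x0)) ba.
have g2 x : 0 <= x -> Dt (Dt (Psum n.+1 b)) x = DtPsum n.+1 a x.
  by move=> x0; rewrite (Dt_ext g1 x0) (Dt_Psum n aM (ltNh0 x0)).
have n0 : 0 < n.+1%:R ^+ 2 :> R by rewrite exprn_gt0// ltr0n.
apply: (@le_trans _ _ (unorm (f \- Psum n.+1 b)%R + (n.+1%:R ^- 2)%:E * unorm (Dt (Dt (Psum n.+1 b))))%E).
  apply: ereal_inf_lbound; exists (Psum n.+1 b) => //; split; first exact: W20_Psum bM.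
  exact: (W2_Psum aM g1).
have r0 : 0 <= c * (l.+1%:R ^+ 2 / n.+1%:R ^+ 2).
  apply: mulr_ge0; last by rewrite divr_ge0 ?exprn_ge0.
  exact: le_trans (addr_ge0 (ler0n _ 307) K0) cK.
apply: le_trans (lee_wpmul2l _ (leeD le1 le2)); last by rewrite lee_fin.
have k1 : (unorm (f \- Psum n.+1 b)%R <= (307 * e1)%:E)%E by exact: unorm_le.
have k2 : (unorm (Dt (Dt (Psum n.+1 b))) <= (K * l.+1%:R ^+ 2 * (e1 + e2))%:E)%E.
  by apply: unorm_le => x x0; rewrite g2// -KE; exact: u_le.
have k3 : ((n.+1%:R ^- 2)%:E * unorm (Dt (Dt (Psum n.+1 b))) <=
    (n.+1%:R ^- 2)%:E * (K * l.+1%:R ^+ 2 * (e1 + e2))%:E)%E.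
  by apply: lee_wpmul2l k2; rewrite lee_fin invr_ge0 ltW.
apply: (le_trans (leeD k1 k3)); rewrite -EFinM -!EFinD -EFinM lee_fin.
have r1 : 1 <= l.+1%:R ^+ 2 / n.+1%:R ^+ 2 :> R.
  rewrite ler_pdivlMr// mul1r ler_pXn2r ?nnegrE//; rewrite ler_nat.
  by apply: leq_trans nl; rewrite leq_pmull.
have -> : n.+1%:R ^- 2 * (K * l.+1%:R ^+ 2 * (e1 + e2)) =
  K * (l.+1%:R ^+ 2 / n.+1%:R ^+ 2) * (e1 + e2) by ring.
move: (_ / _) r1 => r r1; clear -r1 cK K0 e10 e20.
have s0 : 0 <= e1 + e2 by exact: addr_ge0.
apply: (@le_trans _ _ ((307 + K) * r * (e1 + e2))).
  rewrite [leRHS](_ : _ = 307 * (r * (e1 + e2)) + K * r * (e1 + e2)); last by ring.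
  rewrite lerD2r; apply: ler_wpM2l; first exact: ler0n.
  apply: (@le_trans _ _ (1 * (e1 + e2))); first by rewrite mul1r lerDl.
  exact: ler_wpM2r.
by apply: ler_wpM2r => //; apply: ler_wpM2r => //; exact: le_trans ler01 r1.
Qed.

End Bridge.

Theorem theorem1p2 (R : realType) :
  exists (C : R) (L : nat),
    [/\ 0 < C, (0 < L)%N,
        forall (f : R -> R) (l n : nat),
          bounded_continuous f -> (0 < l)%N -> (0 < n)%N -> (L * n <= l)%N ->
          (Kfun f (n%:R ^- 2) <=
             (C * (l%:R ^+ 2 / n%:R ^+ 2))%:E *
             (unorm (Vt n f \- f)%R + unorm (Vt l f \- f)%R))%E
      & exists C' : R, 0 < C' /\
        forall (f : R -> R) (n : nat),
          bounded_continuous f -> (0 < n)%N ->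
          (Kfun f (n%:R ^- 2) <=
             C'%:E *
             (unorm (Vt n f \- f)%R + unorm (Vt (L * n) f \- f)%R))%E].
Proof.
pose K : R := 8 * (18 * 307) + 272 * 272.
have K0 : 0 < K by rewrite /K; lra.
pose C : R := 307 + K.
have C0 : 0 < C by rewrite /C; lra.
have main : forall (f : R -> R) (l n : nat),
  bounded_continuous f -> (0 < l)%N -> (0 < n)%N -> (8 * 272 * n <= l)%N ->
  (Kfun f (n%:R ^- 2) <= (C * (l%:R ^+ 2 / n%:R ^+ 2))%:E *
     (unorm (Vt n f \- f)%R + unorm (Vt l f \- f)%R))%E.
  move=> f [//|l] [//|n] bf _ _ nl.
  exact: (Kfun_le_defect (ltW K0) (lexx _) erefl bf nl).
exists C, (8 * 272)%N; split => //.
exists (C * (8 * 272)%:R ^+ 2); split.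
  by apply: (mulr_gt0 C0); apply: exprn_gt0; rewrite ltr0n.
move=> f n bf n0.
have l0 : (0 < 8 * 272 * n)%N by rewrite muln_gt0 n0.
have := main f (8 * 272 * n)%N n bf l0 n0 (leqnn _).
suff -> : ((8 * 272 * n)%:R ^+ 2 / n%:R ^+ 2 = (8 * 272)%:R ^+ 2 :> R) by [].
rewrite natrM exprMn mulfK// expf_neq0// pnatr_eq0 -lt0n//.
Qed.
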